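(* Let $R$ be a commutative Noetherian ring, $M$ a finitely generated $R$-module, and $C$ a semidualizing $R$-module. Assume $t^{C}(M)<\infty$. Then the following are equivalent. (1) For every integer $i$, $M$ is $i$-$C$-torsionfree if and only if $M$ satisfies $\widetilde{S}^{C}_{i}$. (2) There exists an associated prime $p$ of $\operatorname{Ext}_{R}^{t^{C}(M)+1}(\operatorname{Tr}_{C}M,C)$ such that $t^{C}(M)+1\le \operatorname{depth} C_{p}$.
   Context: A finitely generated $R$-module $C$ is semidualizing if the homothety map $R\to\operatorname{Hom}_R(C,C)$ is an isomorphism and $\operatorname{Ext}^i_R(C,C)=0$ for all $i\ge 1$. For a presentation $P_1\xrightarrow{d_1}P_0\to M\to 0$ of $M$ by finitely generated projective $R$-modules, $\operatorname{Tr}_C M$ denotes the cokernel of $\operatorname{Hom}_R(d_1,C)\colon \operatorname{Hom}_R(P_0,C)\to\operatorname{Hom}_R(P_1,C)$; the modules $\operatorname{Ext}^i_R(\operatorname{Tr}_CM,C)$ with $i\ge1$ do not depend, up to isomorphism, on the chosen presentation. For an integer $n$, $M$ is called $n$-$C$-torsionfree if $\operatorname{Ext}_R^{j}(\operatorname{Tr}_CM,C)=0$ for all $1\le j\le n$ (a vacuous condition if $n\le 0$). $t^{C}(M)$ is the supremum of the integers $n$ such that $M$ is $n$-$C$-torsionfree. For an integer $i$, $M$ satisfies $\widetilde{S}^{C}_{i}$ if $\operatorname{depth} M_p\ge\inf\{i,\operatorname{depth} C_p\}$ for all $p\in\operatorname{Spec}R$. Here depth is taken over the local ring $R_p$, and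 the depth of the zero module is $\infty$. *)

(* Defs.v *)
From HB Require Import structures.
From mathcomp Require Import all_boot all_order all_algebra.
From mathcomp Require Import generic_quotient ring_quotient.
From mathcomp Require Import boolp classical_sets functions constructive_ereal.
From mathcomp Require Import freeg.
From mathcomp Require Import ring zify.

Set Implicit Arguments.
Unset Strict Implicit.
Unset Printing Implicit Defensive.

Import Order.TTheory GRing.Theory Num.Theory.
Import Quotient.Exports.

Local Open Scope classical_set_scope.
Local Open Scope quotient_scope.
Local Open Scope ring_scope.

Section LinearLmodule.
Variables (R : comNzRingType) (U V : lmodType R).
Implicit Types f g h : {linear U -> V}.

Lemma linear_ext f g : f =1 g -> f = g.
Proof.
case: f g => [f fP] [g gP] /= /funext fg; case: _ / fg in gP *.
by congr GRing.Linear.Pack; case: fP gP => [[?] [?]] [[?] [?]];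
   congr GRing.Linear.Class; congr (_ _); exact: Prop_irrelevance.
Qed.

HB.instance Definition _ := gen_eqMixin {linear U -> V}.
HB.instance Definition _ := gen_choiceMixin {linear U -> V}.

Definition lin_zero : {linear U -> V} := \0.
Definition lin_opp f : {linear U -> V} := \- f.
Definition lin_add f g : {linear U -> V} := f \+ g.
Definition lin_scale (a : R) f : {linear U -> V} := a \*: f.

Lemma lin_addA : associative lin_add.
Proof. by move=> f g h; apply: linear_ext => x /=; rewrite addrA. Qed.
Lemma lin_addC : commutative lin_add.
Proof. by move=> f g; apply: linear_ext => x /=; rewrite addrC. Qed.
Lemma lin_add0 : left_id lin_zero lin_add.
Proof. by move=> f; apply: linear_ext => x /=; rewrite add0r. Qed.
Lemma lin_addN : left_inverse lin_zero lin_opp lin_add.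
Proof. by move=> f; apply: linear_ext => x /=; rewrite addNr. Qed.
HB.instance Definition _ :=
  GRing.isZmodule.Build {linear U -> V} lin_addA lin_addC lin_add0 lin_addN.

Lemma lin_scaleA a b f : lin_scale a (lin_scale b f) = lin_scale (a * b) f.
Proof. by apply: linear_ext => x /=; rewrite scalerA. Qed.
Lemma lin_scale1 : left_id 1 lin_scale.
Proof. by move=> f; apply: linear_ext => x /=; rewrite scale1r. Qed.
Lemma lin_scaleDr : right_distributive lin_scale +%R.
Proof. by move=> a f g; apply: linear_ext => x /=; rewrite scalerDr. Qed.
Lemma lin_scaleDl f : {morph lin_scale^~ f : a b / a + b}.
Proof. by move=> a b; apply: linear_ext => x /=; rewrite scalerDl. Qed.
HB.instance Definition _ := GRing.Zmodule_isLmodule.Build R {linear U -> V}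
  lin_scaleA lin_scale1 lin_scaleDr lin_scaleDl.
End LinearLmodule.

Section Precomposition.
Variables (R : comNzRingType) (U U' V : lmodType R) (d : {linear U -> U'}).

(* Hom_R(d, V) : Hom_R(U', V) -> Hom_R(U, V) *)
Definition hom_pre (f : {linear U' -> V}) : {linear U -> V} := f \o d.

Lemma hom_pre_is_linear : linear hom_pre.
Proof. by move=> a f g; apply: linear_ext. Qed.
HB.instance Definition _ := GRing.isLinear.Build R
  {linear U' -> V} {linear U -> V} _ hom_pre hom_pre_is_linear.
End Precomposition.

Arguments hom_pre {R U U'} V d f.

Section Submodules.
Variables (R : comNzRingType).

Structure submod (V : lmodType R) := Submod {
  submod_pred :> {pred V};
  submod_closedP : submod_closed submod_pred
}.

Section SubQuotient.
Variables (V : lmodType R) (S : submod V).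

Lemma submod_subsemimod_closed : subsemimod_closed (submod_pred S).
Proof.
have [S0 SZD] := submod_closedP S; split; first split=> //.
  by move=> x y Sx Sy; rewrite -[x]scale1r SZD.
by move=> a x Sx; rewrite -[_ *: _]addr0 SZD.
Qed.
HB.instance Definition _ :=
  GRing.isSubmodClosed.Build R V (submod_pred S) submod_subsemimod_closed.

Record submodule := Submodule {
  submod_val :> V;
  _ : submod_val \in submod_pred S
}.
HB.instance Definition _ := [isSub for submod_val].
HB.instance Definition _ := [Choice of submodule by <:].
HB.instance Definition _ := [SubChoice_isSubLmodule of submodule by <:].

Definition quotmod := Quotient.quot (submod_pred S).
HB.instance Definition _ := GRing.Zmodule.on quotmod.

Definition quotmod_pi (x : V) : quotmod := \pi x.

Lemma quotmod_piP x y : (quotmod_pi x == quotmod_pi y) = (x - y \in submod_pred S).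
Proof. by rewrite Quotient.idealrBE. Qed.

Lemma quotmod_piK (x : quotmod) : quotmod_pi (repr x) = x.
Proof. exact: reprK. Qed.

Lemma quotmod_piD x y : quotmod_pi (x + y) = quotmod_pi x + quotmod_pi y.
Proof. by rewrite /quotmod_pi raddfD. Qed.

Definition quotmod_scale (a : R) (x : quotmod) := quotmod_pi (a *: repr x).

Lemma quotmod_scale_pi a x : quotmod_scale a (quotmod_pi x) = quotmod_pi (a *: x).
Proof.
apply/eqP; rewrite quotmod_piP -scalerBr rpredZ // -quotmod_piP.
by rewrite quotmod_piK.
Qed.

Lemma quotmod_scaleA a b x :
  quotmod_scale a (quotmod_scale b x) = quotmod_scale (a * b) x.
Proof. by rewrite -[x]quotmod_piK !quotmod_scale_pi scalerA. Qed.
Lemma quotmod_scale1 : left_id 1 quotmod_scale.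
Proof. by move=> x; rewrite -[x]quotmod_piK quotmod_scale_pi scale1r. Qed.
Lemma quotmod_scaleDr : right_distributive quotmod_scale +%R.
Proof.
move=> a x y; rewrite -[x]quotmod_piK -[y]quotmod_piK -quotmod_piD.
by rewrite !quotmod_scale_pi scalerDr quotmod_piD.
Qed.
Lemma quotmod_scaleDl x : {morph quotmod_scale^~ x : a b / a + b}.
Proof.
move=> a b; rewrite -[x]quotmod_piK !quotmod_scale_pi.
by rewrite scalerDl quotmod_piD.
Qed.
HB.instance Definition _ := GRing.Zmodule_isLmodule.Build R quotmod
  quotmod_scaleA quotmod_scale1 quotmod_scaleDr quotmod_scaleDl.

Lemma quotmod_pi_is_linear : linear quotmod_pi.
Proof. by move=> a x y; rewrite quotmod_piD -quotmod_scale_pi. Qed.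
HB.instance Definition _ :=
  GRing.isLinear.Build R V quotmod _ quotmod_pi quotmod_pi_is_linear.
End SubQuotient.

Section SubmodConstructions.
Variables (U V : lmodType R).

Lemma submod0_closed : submod_closed (pred1 (0 : V)).
Proof.
split=> [|a x y]; rewrite !inE // => /eqP-> /eqP->.
by rewrite scaler0 addr0.
Qed.
Definition submod0 := Submod submod0_closed.

Lemma lkernel_closed (f : {linear U -> V}) :
  submod_closed [pred x | f x == 0].
Proof.
split=> [|a x y]; rewrite !inE ?raddf0 // => /eqP fx /eqP fy.
by rewrite linearP fx fy scaler0 addr0.
Qed.
Definition lkernel (f : {linear U -> V}) := Submod (lkernel_closed f).

Lemma limage_closed (f : {linear U -> V}) :
  submod_closed [pred y | `[< exists x, f x = y >]].
Proof.
split=> [|a y z]; rewrite !inE.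
  by exists 0; rewrite raddf0.
move=> [x <-] [t <-].
by exists (a *: x + t); rewrite linearP.
Qed.
Definition limage (f : {linear U -> V}) := Submod (limage_closed f).

Lemma lpreimage_closed (f : {linear U -> V}) (S : submod V) :
  submod_closed [pred x | f x \in submod_pred S].
Proof.
have [S0 SZD] := submod_closedP S.
by split=> [|a x y]; rewrite !inE ?raddf0 // linearP; exact: SZD.
Qed.
Definition lpreimage (f : {linear U -> V}) (S : submod V) :=
  Submod (lpreimage_closed f S).
End SubmodConstructions.

Definition coker (U V : lmodType R) (f : {linear U -> V}) : lmodType R :=
  quotmod (limage f).

(* Z / B for submodules B <= Z of V; in general this is Z / (Z :&: B). *)
Definition subquot (V : lmodType R) (Z B : submod V) : lmodType R :=
  quotmod (lpreimage (\val : {linear submodule Z -> V}) B).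

Definition is_zero (V : lmodType R) : Prop := forall x : V, x = 0.

Definition finitely_generated (V : lmodType R) : Prop :=
  exists (n : nat) (g : 'I_n -> V),
    forall x, exists c : 'I_n -> R, x = \sum_(i < n) c i *: g i.

Definition projective (P : lmodType R) : Prop :=
  forall (A B : lmodType R) (g : {linear A -> B}) (f : {linear P -> B}),
    (forall b, exists a, g a = b) ->
    exists h : {linear P -> A}, forall x, g (h x) = f x.
End Submodules.

(* The submodules of the regular module R^o are the ideals of R. *)
Definition noetherian (R : comNzRingType) : Prop :=
  forall I : submod R^o, finitely_generated (submodule I).

Section Ext.
Variable R : comNzRingType.

Record resolution (M : lmodType R) := Resolution {
  res_obj : nat -> lmodType R;
  res_d : forall n, {linear res_obj n.+1 -> res_obj n};
  res_aug : {linear res_obj 0 -> M};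
  res_projective : forall n, projective (res_obj n);
  res_aug_surj : forall x, exists y, res_aug y = x;
  res_exact0 : forall x, res_aug x = 0 <-> exists y, res_d 0 y = x;
  res_exact : forall n x, res_d n x = 0 <-> exists y, res_d n.+1 y = x
}.

Section ExtOf.
Variables (M : lmodType R) (P : resolution M) (N : lmodType R).

Definition cocycles (i : nat) : submod {linear res_obj P i -> N} :=
  lkernel (hom_pre N (res_d P i)).

Definition coboundaries (i : nat) : submod {linear res_obj P i -> N} :=
  match i with
  | 0 => submod0 _
  | j.+1 => limage (hom_pre N (res_d P j))
  end.

Definition Ext_of (i : nat) : lmodType R :=
  subquot (cocycles i) (coboundaries i).
End ExtOf.

(* The canonical free resolution of M: every syzygy is covered by the free
   module {freeg _ / R} on all of its elements. *)
Section StdResolution.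

Definition free_cover (V : lmodType R) (x : {freeg V / R}) : V := fglift id x.

Lemma free_coverU (V : lmodType R) (a : R) (v : V) :
  free_cover << a *g v >> = a *: v.
Proof. exact: liftU. Qed.

Lemma fglift_is_linear (K : choiceType) (V : lmodType R) (f : K -> V) :
  linear (fglift f : {freeg K / R} -> V).
Proof.
have fgB : {morph fglift f : x y / x - y} by exact: lift_is_additive.
have fg0 : fglift f 0 = 0 by rewrite -(subrr 0) fgB subrr.
have fgD : {morph fglift f : x y / x + y}.
  by move=> x y; rewrite -[in LHS](opprK y) -[- y]add0r !fgB fg0 sub0r opprK.
have fgsum (r : seq K) (F : K -> {freeg K / R}) :
  fglift f (\sum_(k <- r) F k) = \sum_(k <- r) fglift f (F k).
  by apply: (big_morph (fglift f)).
move=> a x y; rewrite fgD; congr (_ + _).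
rewrite -[in RHS](freeg_sumE x) fgsum scaler_sumr [LHS]fgsum.
by apply: eq_bigr => k _; rewrite !liftU scalerA.
Qed.
HB.instance Definition _ (V : lmodType R) :=
  GRing.isLinear.Build R {freeg V / R} V _ (@free_cover V)
    (fglift_is_linear (@id V)).

Lemma free_cover_surj (V : lmodType R) (v : V) : exists x, free_cover x = v.
Proof. by exists << 1 *g v >>; rewrite free_coverU scale1r. Qed.

Lemma freeg_projective (K : choiceType) : projective {freeg K / R}.
Proof.
move=> A B g f g_surj.
have [h hP] := choice (fun k : K => g_surj (f << 1 *g k >>)).
pose h' := HB.pack_for {linear {freeg K / R} -> A} (fglift h)
  (GRing.isLinear.Build R {freeg K / R} A _ (fglift h) (fglift_is_linear h)).
exists h' => x; rewrite -(freeg_sumE x) !linear_sum; apply: eq_bigr => k _.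
have -> : << coeff k x *g k >> = coeff k x *: << 1 *g k >>.
  by apply/eqP/freeg_eqP => l; rewrite coeffZ !coeffU mul1r.
rewrite !linearZ /=; congr (_ *: _).
by rewrite liftU scale1r hP.
Qed.

Variable M : lmodType R.

Fixpoint syzygy (n : nat) : lmodType R :=
  match n with
  | 0 => M
  | m.+1 => submodule (lkernel (@free_cover (syzygy m)))
  end.

Definition std_obj (n : nat) : lmodType R := {freeg (syzygy n) / R}.

Definition std_d (n : nat) : {linear std_obj n.+1 -> std_obj n} :=
  (\val : {linear submodule (lkernel (@free_cover (syzygy n))) -> _})
    \o @free_cover (syzygy n.+1).

Lemma std_d_exact n (x : std_obj n) :
  free_cover x = 0 <-> exists y, std_d n y = x.
Proof.
split=> [x0|[y <-]]; last first.
  exact/eqP/(valP (free_cover y : submodule (lkernel (@free_cover _)))).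
have kx : x \in lkernel (@free_cover (syzygy n)) by exact/eqP.
have [y yP] := free_cover_surj (Submodule kx : syzygy n.+1).
by exists y; rewrite /std_d /= yP.
Qed.

Lemma std_exact n (x : std_obj n.+1) :
  std_d n x = 0 <-> exists y, std_d n.+1 y = x.
Proof.
rewrite -std_d_exact; split=> [dx0|xP]; last by rewrite /std_d /= xP.
exact/val_inj.
Qed.

Definition std_resolution : resolution M :=
  @Resolution M std_obj std_d (@free_cover M)
    (fun n => @freeg_projective (syzygy n)) (@free_cover_surj M)
    (@std_d_exact 0) std_exact.
End StdResolution.

Definition Ext (i : nat) (M N : lmodType R) : lmodType R :=
  Ext_of (std_resolution M) N i.
End Ext.

Section Localization.
Variables (R : comNzRingType) (p : prime_idealr R).

Record denominator := Denominator {
  den : R;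
  _ : den \notin (p : {pred R})
}.
HB.instance Definition _ := [isSub for den].
HB.instance Definition _ := [Choice of denominator by <:].

Lemma den1_subproof : 1 \notin (p : {pred R}).
Proof. by rewrite idealr1. Qed.
Definition den1 := Denominator den1_subproof.

Lemma denM_subproof (s t : denominator) : den s * den t \notin (p : {pred R}).
Proof. by rewrite prime_idealrM negb_or (valP s) (valP t). Qed.
Definition denM s t := Denominator (denM_subproof s t).

Section Fractions.
Variable M : lmodType R.

(* m / s = n / t iff w t m = w s n for some w outside p *)
Definition frac_eq (x y : M * denominator) : bool :=
  `[< exists w : denominator,
        (den w * den y.2) *: x.1 = (den w * den x.2) *: y.1 >].

Lemma frac_eq_is_equiv : equiv_class_of frac_eq.
Proof.
have sym x y : frac_eq x y -> frac_eq y x.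
  by move=> /asboolP[w e]; apply/asboolP; exists w.
split=> [x|x y|y x z].
- by apply/asboolP; exists den1.
- by apply/idP/idP; apply: sym.
- move=> /asboolP[w e] /asboolP[w' e']; apply/asboolP.
  exists (denM (denM w w') y.2) => /=.
  transitivity ((den w' * den z.2) *: ((den w * den y.2) *: x.1)).
    by rewrite scalerA; congr (_ *: _); ring.
  rewrite e; transitivity ((den w * den x.2) *: ((den w' * den z.2) *: y.1)).
    by rewrite !scalerA; congr (_ *: _); ring.
  by rewrite e' scalerA; congr (_ *: _); ring.
Qed.
Canonical frac_equiv := EquivRelPack frac_eq_is_equiv.
Canonical frac_encModRel := defaultEncModRel frac_eq.

Definition localization := {eq_quot frac_eq}.
HB.instance Definition _ := Choice.on localization.

Definition frac (m : M) (s : denominator) : localization := \pi_localization (m, s).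

Lemma frac_eqP m s n t :
  frac m s = frac n t <->
  exists w : denominator, (den w * den t) *: m = (den w * den s) *: n.
Proof.
rewrite /frac; split=> [/eqquotP/asboolP//|e].
by apply/eqquotP/asboolP.
Qed.

Lemma fracK (x : localization) : frac (repr x).1 (repr x).2 = x.
Proof. by rewrite /frac -surjective_pairing reprK. Qed.

Lemma frac_ind (P : localization -> Prop) :
  (forall m s, P (frac m s)) -> forall x, P x.
Proof. by move=> Pf x; rewrite -(fracK x). Qed.

Lemma repr_frac m s : exists w : denominator,
  (den w * den s) *: (repr (frac m s)).1 =
  (den w * den (repr (frac m s)).2) *: m.
Proof. by apply/frac_eqP; rewrite fracK. Qed.

Definition loc_zero : localization := frac 0 den1.
Definition loc_opp (x : localization) := frac (- (repr x).1) (repr x).2.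
Definition loc_add (x y : localization) :=
  frac (den (repr y).2 *: (repr x).1 + den (repr x).2 *: (repr y).1 : M)
       (denM (repr x).2 (repr y).2).

Lemma loc_opp_frac m s : loc_opp (frac m s) = frac (- m) s.
Proof.
have [w e] := repr_frac m s.
by apply/frac_eqP; exists w; rewrite !scalerN e.
Qed.

Lemma loc_add_frac m s n t :
  loc_add (frac m s) (frac n t) = frac (den t *: m + den s *: n) (denM s t).
Proof.
have [w e] := repr_frac m s; have [w' e'] := repr_frac n t.
apply/frac_eqP; exists (denM w w') => /=.
set x := repr (frac m s) in e *; set y := repr (frac n t) in e' *.
rewrite !scalerDr !scalerA; congr (_ + _).
  transitivity ((den w' * den t * den y.2) *: ((den w * den s) *: x.1)).
    by rewrite scalerA; congr (_ *: _); ring.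
  by rewrite e scalerA; congr (_ *: _); ring.
transitivity ((den w * den s * den x.2) *: ((den w' * den t) *: y.1)).
  by rewrite scalerA; congr (_ *: _); ring.
by rewrite e' scalerA; congr (_ *: _); ring.
Qed.

Lemma loc_addA : associative loc_add.
Proof.
elim/frac_ind=> m s; elim/frac_ind=> n t; elim/frac_ind=> k u.
rewrite !loc_add_frac; apply/frac_eqP; exists den1.
rewrite /= !scalerDr !scalerA !addrA.
by congr (_ *: _ + _ *: _ + _ *: _); ring.
Qed.
Lemma loc_addC : commutative loc_add.
Proof.
elim/frac_ind=> m s; elim/frac_ind=> n t.
rewrite !loc_add_frac; apply/frac_eqP; exists den1.
rewrite /= addrC !scalerDr !scalerA.
by congr (_ *: _ + _ *: _); ring.
Qed.
Lemma loc_add0 : left_id loc_zero loc_add.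
Proof.
elim/frac_ind=> m s; rewrite loc_add_frac; apply/frac_eqP; exists den1.
by rewrite /= scaler0 add0r scale1r !mul1r.
Qed.
Lemma loc_addN : left_inverse loc_zero loc_opp loc_add.
Proof.
elim/frac_ind=> m s; rewrite loc_opp_frac loc_add_frac.
apply/frac_eqP; exists den1.
by rewrite /= scalerN addNr !scaler0.
Qed.
HB.instance Definition _ :=
  GRing.isZmodule.Build localization loc_addA loc_addC loc_add0 loc_addN.
End Fractions.

Definition loc_ring := localization R^o.
HB.instance Definition _ := GRing.Zmodule.on loc_ring.

Section Scale.
Variable M : lmodType R.

Definition loc_scale (a : loc_ring) (x : localization M) : localization M :=
  frac ((repr a).1 *: (repr x).1) (denM (repr a).2 (repr x).2).

Lemma loc_scale_frac (r : R^o) s (m : M) t :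
  loc_scale (frac r s) (frac m t) = frac (r *: m) (denM s t).
Proof.
have [w e] := repr_frac r s; have [w' e'] := repr_frac m t.
apply/frac_eqP; exists (denM w w') => /=.
set a := repr (frac r s) in e *; set x := repr (frac m t) in e' *.
have {}e : den w * den s * a.1 = den w * den a.2 * r by [].
transitivity ((den w * den s * a.1) *: ((den w' * den t) *: x.1)).
  by rewrite !scalerA; congr (_ *: _); ring.
by rewrite e e' !scalerA; congr (_ *: _); ring.
Qed.
End Scale.

Definition loc_one : loc_ring := frac (1 : R^o) den1.
Definition loc_mul (a b : loc_ring) : loc_ring := loc_scale a b.

Lemma loc_mul_frac (a b : R) s t :
  loc_mul (frac (a : R^o) s) (frac (b : R^o) t) = frac (a * b : R^o) (denM s t).
Proof. exact: loc_scale_frac. Qed.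

Lemma loc_scaleA M a b (x : localization M) :
  loc_scale a (loc_scale b x) = loc_scale (loc_mul a b) x.
Proof.
elim/frac_ind: a => a s; elim/frac_ind: b => b t; elim/frac_ind: x => m u.
rewrite loc_mul_frac (loc_scale_frac b t) !loc_scale_frac; apply/frac_eqP; exists den1 => /=.
by rewrite !scalerA; congr (_ *: _); ring.
Qed.
Lemma loc_scale1 M : left_id loc_one (@loc_scale M).
Proof.
elim/frac_ind=> m s; rewrite loc_scale_frac; apply/frac_eqP; exists den1 => /=.
by rewrite scale1r !mul1r.
Qed.
Lemma loc_scaleDr M : right_distributive (@loc_scale M) +%R.
Proof.
elim/frac_ind=> a s; elim/frac_ind=> m t; elim/frac_ind=> n u.
rewrite [_ + _]loc_add_frac !loc_scale_frac [RHS]loc_add_frac.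
apply/frac_eqP; exists den1 => /=.
rewrite !scalerDr !scalerA.
by congr (_ *: _ + _ *: _); ring.
Qed.
Lemma loc_scaleDl M (x : localization M) : {morph (@loc_scale M)^~ x : a b / a + b}.
Proof.
elim/frac_ind: x => m u; elim/frac_ind=> a s; elim/frac_ind=> b t.
rewrite [_ + _]loc_add_frac !loc_scale_frac [RHS]loc_add_frac.
apply/frac_eqP; exists den1 => /=.
rewrite !scalerDr !scalerA -scalerDl.
have E (c d : R) : c *: (d : R^o) = c * d by [].
by congr (_ *: _); rewrite !E; ring.
Qed.
Lemma loc_mulC : commutative loc_mul.
Proof.
elim/frac_ind=> a s; elim/frac_ind=> b t.
rewrite !loc_mul_frac mulrC; apply/frac_eqP; exists den1 => /=.
by rewrite [den t * den s]mulrC.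
Qed.
Lemma loc_one_neq0 : loc_one != 0.
Proof.
apply/eqP => /frac_eqP[w]; rewrite /GRing.scale /= !mulr0 !mulr1 => w0.
by have := valP w; rewrite /= w0 rpred0.
Qed.
HB.instance Definition _ := GRing.Zmodule_isComNzRing.Build loc_ring
  (@loc_scaleA R^o) loc_mulC (@loc_scale1 R^o)
  (fun a b c => @loc_scaleDl R^o c a b) loc_one_neq0.

HB.instance Definition _ (M : lmodType R) :=
  GRing.Zmodule_isLmodule.Build loc_ring (localization M)
    (@loc_scaleA M) (@loc_scale1 M) (@loc_scaleDr M) (@loc_scaleDl M).

(* p R_p *)
Definition loc_max : set loc_ring :=
  [set x | exists (a : R) (s : denominator),
     a \in (p : {pred R}) /\ x = frac (a : R^o) s].
End Localization.

Definition int_sup (A : set int) : \bar int := supremum -oo%E (EFin @` A).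

(* int_sup never falls back on a default value when A is nonempty *)
Lemma int_supP (A : set int) : A !=set0 ->
  supremums (EFin @` A : set (\bar int)) (int_sup A).
Proof.
move=> [a Aa]; rewrite /int_sup /supremum ifF; last first.
  by apply/negP => /eqP A0; have : (EFin @` A) a%:E by [exists a]; rewrite A0.
apply: xgetPex; have [[b bP]|Aoo] := pselect (exists b, forall n, A n -> n <= b).
  pose Q k := `[< exists n, A n /\ absz (b - n) = k >].
  have exQ : exists k, Q k by exists (absz (b - a)); apply/asboolP; exists a.
  case: (ex_minnP exQ) => k /asboolP[n [An nk]] kmin.
  exists n%:E; split=> [_ [m Am <-]|u]; last by apply; exists n.
  have : (k <= absz (b - m))%N by apply: kmin; apply/asboolP; exists m.
  have := bP m Am; have := bP n An; rewrite lee_fin; lia.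
exists +oo%E; split=> [x _|u uP]; first exact: leey.
case: u uP => [r rP||] //; last by move=> /(_ a%:E); apply; exists a.
by case: Aoo; exists r => n An; rewrite -lee_fin; apply: rP; exists n.
Qed.

Section Depth.
Variables (S : comNzRingType) (N : lmodType S).

(* (x_1, ..., x_k) N, for s = [:: x_1; ...; x_k] *)
Definition seq_mul (s : seq S) : set N :=
  [set n | exists c : 'I_(size s) -> N, n = \sum_(i < size s) s`_i *: c i].

(* x_(i+1) is a nonzerodivisor on N / (x_1, ..., x_i) N for all i, and
   N / (x_1, ..., x_k) N != 0. *)
Definition regular_seq (s : seq S) : Prop :=
  (forall i : nat, (i < size s)%N -> forall n : N,
     seq_mul (take i s) (s`_i *: n) -> seq_mul (take i s) n) /\
  exists n : N, ~ seq_mul s n.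

(* For S local with maximal ideal I this is the depth of N. *)
Definition depth (I : set S) : \bar int :=
  if `[< is_zero N >] then +oo%E
  else int_sup [set (size s)%:Z | s in [set s : seq S |
      (forall x, x \in s -> I x) /\ regular_seq s]].
End Depth.

Definition depth_at (R : comNzRingType) (p : prime_idealr R) (M : lmodType R) :
  \bar int := depth (localization p M) (@loc_max R p).

Section Torsionfree.
Variable R : comNzRingType.

Definition homothety (C : lmodType R) (r : R) : {linear C -> C} :=
  r \*: (idfun : {linear C -> C}).

Definition semidualizing (C : lmodType R) : Prop :=
  [/\ finitely_generated C,
      bijective (homothety C) &
      forall i : nat, (1 <= i)%N -> is_zero (Ext i C C)].

Definition is_associated (p : prime_idealr R) (E : lmodType R) : Prop :=
  exists x : E, forall a : R, (a \in (p : {pred R})) = (a *: x == 0).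

Definition fg_proj_presentation (M P0 P1 : lmodType R)
    (d1 : {linear P1 -> P0}) (d0 : {linear P0 -> M}) : Prop :=
  [/\ finitely_generated P0 /\ projective P0,
      finitely_generated P1 /\ projective P1,
      forall m, exists x, d0 x = m &
      forall x, d0 x = 0 <-> exists y, d1 y = x].

Section TrC.
(* P1 -> P0 -> M -> 0 is a presentation of M; the notions below are attached
   to M through it. *)
Variables (C P0 P1 : lmodType R) (d1 : {linear P1 -> P0}).

Definition Tr : lmodType R := coker (hom_pre C d1).

Definition torsionfree (n : int) : Prop :=
  forall j : nat, (1 <= j)%N -> j%:Z <= n -> is_zero (Ext j Tr C).

Definition torsionfree_index : \bar int :=
  int_sup torsionfree.

Lemma torsionfree_index_ge0 : (0 <= torsionfree_index)%E.
Proof.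
have tf0 : torsionfree 0 by move=> j j1; rewrite lez_nat leqn0; case: j j1.
by have [ub _] := int_supP (ex_intro _ 0 tf0); apply: ub; exists 0.
Qed.
End TrC.

Definition Stilde (C M : lmodType R) (i : int) : Prop :=
  forall p : prime_idealr R,
    (Order.min i%:E (depth_at p C) <= depth_at p M)%E.
End Torsionfree.

(* Main.v *)
From HB Require Import structures.
From mathcomp Require Import freeg.
From mathcomp Require Import all_boot all_order all_algebra.
From mathcomp Require Import ring_quotient constructive_ereal.
From mathcomp Require Import generic_quotient boolp classical_sets.
From mathcomp Require Import ring zify.
Require Import Defs.

Set Implicit Arguments.
Unset Strict Implicit.
Unset Printing Implicit Defensive.

Import Order.TTheory GRing.Theory Num.Theory.
Import Quotient.Exports.

Local Open Scope classical_set_scope.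
Local Open Scope ring_scope.

(* Write (-)^+ for Hom(-, C) and T = Tr M = coker(P0^+ -> P1^+).  Prolonging
   P0^+ -> P1^+ -> T by a resolution of the kernel by finite free modules F_i
   gives a resolution of T by Hom(-, C)-acyclic modules; since P = P^++ for P
   finitely generated projective, its dual shows that Ext^(j+1)(T, C) is the
   cohomology in degree j of a complex
       0 -> M -> F_0^+ -> F_1^+ -> ...
   whose terms in positive degree are finite sums of copies of C.  Let
   t = t^C(M), so that this complex is exact in degrees < t.  Localize at p and
   let k be the residue field: splitting the complex into short exact sequences
   gives depth M_p >= min(t, depth C_p), and when depth C_p > t it shows that
   Ext^t(k, M_p) vanishes iff Hom(k, -) vanishes on the localized cohomology in
   degree t, that is, iff p is not associated to Ext^(t+1)(T, C).  So S~_i holds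
   for all i <= t, and S~_(t+1) fails exactly when (2) holds.  Depth is detected
   by Ext(k, -) as usual, through prime avoidance and Nakayama's lemma. *)

(** * Linear maps *)

Section LinearMaps.
Variable R : comNzRingType.
Implicit Types U V W A B D P Q : lmodType R.

(** Ext(T, C) comes from one canonical free resolution, whose terms are in general not finitely
    generated, while depth is taken over R_p; the two are never compared directly. Only the complex
    built from C is localized: being a summand of a finite sum of copies of C passes to R_p by
    localizing maps, so Ext^j(k, -) vanishes on the positive terms for j < depth C_p. Associated
    primes are annihilators of single classes, hence the passage from the canonical resolution to
    the acyclic one has to control classes and not merely vanishing; this is the purpose of the
    mapping cone. Vanishing of Ext^i(C, C) makes Hom(P_i, C) acyclic although it need not be
    projective, and the homothety isomorphism gives P = P^++. The double dual of P1 -> P0 has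
    cokernel M, which replaces it at the start of the complex and accounts for the shift from j + 1
    to j. At a prime with depth C_p <= t, the bound depth M_p >= min(t, depth C_p) already gives
    S~_i for every i, so only primes with depth C_p > t can violate it; this is the origin of the
    inequality in (2). *)

Definition mklinear U V (f : U -> V) (fP : linear f) : {linear U -> V} :=
  HB.pack f (GRing.isLinear.Build R U V *:%R f fP).

Lemma linear_congr U V (f g : {linear U -> V}) : f = g -> f =1 g.
Proof. by move->. Qed.

Lemma factor_surj U V W (p : {linear U -> V}) (f : {linear U -> W}) :
  (forall v, exists u, p u = v) -> (forall u, p u = 0 -> f u = 0) ->
  exists g : {linear V -> W}, forall u, g (p u) = f u.
Proof.
move=> p_surj kerP; have [s sP] := choice p_surj.
have fE u v : p u = p v -> f u = f v.
  by move=> e; apply/eqP; rewrite -subr_eq0 -linearB kerP // linearB e subrr.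
have g_lin : linear (f \o s).
  by move=> a x y /=; rewrite -linearP; apply: fE; rewrite linearP !sP.
by exists (mklinear g_lin) => u /=; apply: fE; rewrite sP.
Qed.

Lemma factor_inj U V W (i : {linear V -> W}) (f : {linear U -> W}) :
  injective i -> (forall u, exists v, i v = f u) ->
  exists g : {linear U -> V}, forall u, i (g u) = f u.
Proof.
move=> i_inj imP; have [g gP] := choice imP.
have g_lin : linear g.
  by move=> a x y; apply: i_inj; rewrite linearP !gP linearP.
by exists (mklinear g_lin).
Qed.

Lemma projective_lift P V W (e : {linear V -> W})
    (f : {linear P -> W}) :
  projective P -> (forall x, exists v, e v = f x) ->
  exists g : {linear P -> V}, forall x, e (g x) = f x.
Proof.
(* Projectivity is stated for surjections only, so [e] is corestricted to its image. *)
move=> Pproj imP; pose I := submodule (limage e).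
have [e' e'P] : exists e' : {linear V -> I}, forall v, val (e' v) = e v.
  apply: factor_inj; first exact: val_inj.
  move=> v; have Iv : e v \in limage e by apply/asboolP; exists v.
  by exists (Submodule Iv).
have [f' f'P] : exists f' : {linear P -> I}, forall x, val (f' x) = f x.
  apply: factor_inj; first exact: val_inj.
  by move=> x; have Ix : f x \in limage e by [apply/asboolP]; exists (Submodule Ix).
have e'_surj y : exists v, e' v = y.
  have /asboolP[v ve] := valP y; exists v; apply: val_inj; rewrite e'P; exact: ve.
have [g gP] := Pproj _ _ e' f' e'_surj.
by exists g => x; rewrite -e'P gP f'P.
Qed.

Definition ses A B D (i : {linear A -> B}) (p : {linear B -> D}) : Prop :=
  [/\ injective i, forall d, exists b, p b = d &
      forall b, p b = 0 <-> exists a, i a = b].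

Lemma ses_comp0 A B D (i : {linear A -> B}) (p : {linear B -> D}) a :
  ses i p -> p (i a) = 0.
Proof. by move=> [_ _ ex]; apply/ex; exists a. Qed.

Lemma ses_kernel B D (p : {linear B -> D}) :
  (forall d, exists b, p b = d) ->
  ses (\val : {linear submodule (lkernel p) -> B}) p.
Proof.
move=> p_surj; split=> //; first exact: val_inj.
move=> b; split=> [b0|[a <-]]; last exact/eqP/(valP a).
have kb : b \in lkernel p by apply/eqP.
by exists (Submodule kb).
Qed.

Lemma quotmod_pi_eq0 V (S : submod V) x : (quotmod_pi S x == 0) = (x \in S).
Proof. by rewrite -(linear0 (quotmod_pi S)) quotmod_piP subr0. Qed.

Lemma quotmod_piZ V (S : submod V) a x :
  a *: quotmod_pi S x = quotmod_pi S (a *: x).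
Proof. by rewrite linearZ. Qed.

Lemma fst_linear U V : linear (fst : U * V -> U).
Proof. by []. Qed.
Lemma snd_linear U V : linear (snd : U * V -> V).
Proof. by []. Qed.
Lemma inl_linear U V : linear (fun u : U => (u, 0) : U * V).
Proof. by move=> a x y; congr pair; rewrite /= scaler0 addr0. Qed.
Lemma inr_linear U V : linear (fun v : V => (0, v) : U * V).
Proof. by move=> a x y; congr pair; rewrite /= scaler0 addr0. Qed.

Definition lfst U V : {linear (U * V)%type -> U} := mklinear (@fst_linear U V).
Definition lsnd U V : {linear (U * V)%type -> V} := mklinear (@snd_linear U V).
Definition linl U V : {linear U -> (U * V)%type} := mklinear (@inl_linear U V).
Definition linr U V : {linear V -> (U * V)%type} := mklinear (@inr_linear U V).

Lemma pair_linear U V W (f : {linear U -> V}) (g : {linear U -> W}) :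
  linear (fun u => (f u, g u) : V * W).
Proof. by move=> a x y; rewrite !linearP. Qed.
Definition lpair U V W (f : {linear U -> V}) (g : {linear U -> W}) :
  {linear U -> (V * W)%type} := mklinear (pair_linear f g).

Lemma copair_linear U V W (f : {linear U -> W}) (g : {linear V -> W}) :
  linear (fun u : U * V => f u.1 + g u.2).
Proof. by move=> a x y; rewrite !linearP scalerDr addrACA. Qed.
Definition lcopair U V W (f : {linear U -> W}) (g : {linear V -> W}) :
  {linear (U * V)%type -> W} := mklinear (copair_linear f g).

Lemma projective_pair P Q :
  projective P -> projective Q -> projective (P * Q)%type.
Proof.
move=> Pp Qp A B g f gs.
have [h hP] := Pp _ _ g (f \o linl P Q) gs.
have [k kP] := Qp _ _ g (f \o linr P Q) gs.
exists (lcopair h k) => -[x y] /=.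
by rewrite linearD hP kP /= -linearD; congr (f (_, _)); rewrite ?addr0 ?add0r.
Qed.

Lemma ses_pair U V : ses (linl U V) (lsnd U V).
Proof.
split=> [x y []|y|[x y]] //; first by exists (0, y).
by split=> [/= ->|[a [_ <-]]] //; exists x.
Qed.

Lemma ses_split A P B (i : {linear A -> B}) (p : {linear B -> P}) :
  projective P -> ses i p ->
  exists (s : {linear P -> B}) (r : {linear B -> A}),
    [/\ forall x, p (s x) = x, forall a, r (i a) = a &
        forall b, b = i (r b) + s (p b)].
Proof.
move=> Pp [i_inj p_surj ex].
have [s sP] := Pp _ _ p idfun p_surj.
have [r rP] : exists r : {linear B -> A}, forall b, i (r b) = (idfun \- (s \o p)) b.
  apply: factor_inj => // b; apply/ex.
  by rewrite /= linearB sP subrr.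
exists s, r; split=> // [a|b]; last by rewrite rP /= subrK.
have pia : p (i a) = 0 by apply/ex; exists a.
by apply: i_inj; rewrite rP /= pia linear0 subr0.
Qed.

End LinearMaps.

(** * Vanishing of Ext in the first variable *)

Section Pullback.
Variable R : comNzRingType.
Implicit Types A B D Y W Z : lmodType R.

(** The fibre product is returned as an abstract module with its characteristic properties, so that
    no later proof unfolds the subtype. *)
Lemma pullback_exists B Y D (p : {linear B -> D}) (f : {linear Y -> D}) :
  exists (W : lmodType R) (h : {linear W -> B}) (q : {linear W -> Y}),
  [/\ forall w, p (h w) = f (q w),
      forall b y, p b = f y -> exists w, h w = b /\ q w = y,
      forall w, h w = 0 -> q w = 0 -> w = 0 &
      forall Z (u : {linear Z -> B}) (v : {linear Z -> Y}),
        (forall z, p (u z) = f (v z)) ->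
        exists t : {linear Z -> W}, forall z, h (t z) = u z /\ q (t z) = v z].
Proof.
pose k := lcopair p (\- f : {linear Y -> D}).
pose W := submodule (lkernel k).
pose e : {linear W -> (B * Y)%type} := \val.
have kP b y : ((b, y) \in lkernel k) = (p b == f y).
  by rewrite inE /= subr_eq0.
exists W, (lfst B Y \o e), (lsnd B Y \o e); split.
- move=> w; apply/eqP; rewrite -kP.
  by move: (valP w) => /=; case: (val w).
- move=> b y /eqP e_by; rewrite -kP in e_by.
  by exists (Submodule e_by : W).
- move=> w /= w1 w2; apply: val_inj => /=.
  by case: (val w) w1 w2 => b y /= -> ->.
- move=> Z u v uv.
  have [t tP] : exists t : {linear Z -> W}, forall z, e (t z) = lpair u v z.
    apply: factor_inj; first exact: val_inj.
    move=> z; have kz : (u z, v z) \in lkernel k by rewrite kP uv.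
    by exists (Submodule kz).
  by exists t => z /=; have /= -> := tP z.
Qed.

Lemma ses_pullback A B Y D W (i : {linear A -> B}) (p : {linear B -> D})
    (f : {linear Y -> D}) (h : {linear W -> B}) (q : {linear W -> Y}) :
  ses i p -> (forall w, p (h w) = f (q w)) ->
  (forall b y, p b = f y -> exists w, h w = b /\ q w = y) ->
  (forall w, h w = 0 -> q w = 0 -> w = 0) ->
  exists j : {linear A -> W}, ses j q /\ forall a, h (j a) = i a.
Proof.
move=> sip sq ex jinj; have [i_inj p_surj exi] := sip.
have jinj' w w' : h w = h w' -> q w = q w' -> w = w'.
  move=> hw qw; apply/eqP; rewrite -subr_eq0.
  by apply/eqP/jinj; rewrite linearB ?hw ?qw subrr.
have j_ex a : exists w, h w = i a /\ q w = 0.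
  by apply: ex; rewrite (ses_comp0 _ sip) linear0.
have [j jP] := choice j_ex.
have j_lin : linear j.
  move=> a x y; have [h1 q1] := jP (a *: x + y).
  have [hx qx] := jP x; have [hy qy] := jP y.
  by apply: jinj'; rewrite linearP ?h1 ?q1 ?hx ?hy ?qx ?qy ?linearP ?scaler0 ?addr0.
exists (mklinear j_lin); split=> [|a]; last by case: (jP a).
split.
- move=> x y /= e; apply: i_inj.
  by have [<- _] := jP x; have [<- _] := jP y; rewrite e.
- move=> y; have [b pb] := p_surj (f y).
  by have [w [_ <-]] := ex _ _ pb; exists w.
- move=> w; split=> [qw|[a <-]]; last by case: (jP a).
  have /exi[a ia] : p (h w) = 0 by rewrite sq qw linear0.
  exists a => /=; have [hj qj] := jP a.
  by apply: jinj'; rewrite ?hj ?qj ?ia ?qw.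
Qed.

End Pullback.

Section ExtVanish.
Variables (R : comNzRingType) (C : lmodType R).
Implicit Types A B D X Y Z K P : lmodType R.

(** This is Ext^1(X, C) = 0: [f] extends along [i] exactly when the extension of X by C pushed out
    along [f] splits. Quantifying over all extensions makes closure properties accessible to
    pullback arguments. *)
Definition ext1_zero X : Prop :=
  forall A B (i : {linear A -> B}) (p : {linear B -> X}), ses i p ->
  forall f : {linear A -> C}, exists g : {linear B -> C}, forall a, g (i a) = f a.

(* [ext_vanish n X] says that Ext^(n+1)(X, C) = 0. *)
Fixpoint ext_vanish (n : nat) X : Prop :=
  match n with
  | 0 => ext1_zero X
  | m.+1 => forall K P (i : {linear K -> P}) (p : {linear P -> X}),
      projective P -> ses i p -> ext_vanish m K
  end.

Lemma projective_retract P Y (s : {linear P -> Y}) (r : {linear Y -> P}) :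
  (forall x, r (s x) = x) -> projective Y -> projective P.
Proof.
move=> rs Yp A B g f gs; have [h hP] := Yp _ _ g (f \o r) gs.
by exists (h \o s) => x /=; rewrite hP /= rs.
Qed.

Lemma ext_vanish_projective n P : projective P -> ext_vanish n P.
Proof.
elim: n P => [|n IHn] P Pp.
  move=> A B i p sip f; have [s [r [_ ri _]]] := ses_split Pp sip.
  by exists (f \o r) => a /=; rewrite ri.
move=> K Q i p Qp sip; apply: IHn.
by have [s [r [_ ri _]]] := ses_split Pp sip; exact: projective_retract Qp.
Qed.

Lemma free_ses X : exists K P (i : {linear K -> P}) (p : {linear P -> X}),
  projective P /\ ses i p.
Proof.
exists _, _, (\val : {linear submodule (lkernel (@free_cover R X)) -> _}),
  (@free_cover R X); split; first exact: freeg_projective.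
exact/ses_kernel/free_cover_surj.
Qed.

(** Pull the extension of X back along [r] to an extension W of Y. The pair of the identity and
    [s \o p] embeds B into W, and the extended map is restricted along it. *)
Lemma ext1_zero_retract X Y (s : {linear X -> Y}) (r : {linear Y -> X}) :
  (forall x, r (s x) = x) -> ext1_zero Y -> ext1_zero X.
Proof.
move=> rs Y0 A B i p sip f.
have [W [h [q [sq ex jinj univ]]]] := pullback_exists p r.
have [j [sjq hj]] := ses_pullback sip sq ex jinj.
have [g gP] := Y0 _ _ _ _ sjq f.
have [t tP] := univ _ idfun (s \o p) (fun b => esym (rs (p b))).
exists (g \o t) => a /=; rewrite -gP; congr (g _).
have [/= h1 q1] := tP (i a).
apply/eqP; rewrite -subr_eq0; apply/eqP/jinj; rewrite linearB ?h1 ?q1.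
  by rewrite hj subrr.
by rewrite (ses_comp0 _ sip) linear0 (ses_comp0 _ sjq) subrr.
Qed.

(** The map is extended in two stages: to the part W of E lying over A, then from W to E, whose
    quotient by W is D. *)
Lemma ext1_zero_ses A B D (i : {linear A -> B}) (p : {linear B -> D}) :
  ses i p -> ext1_zero A -> ext1_zero D -> ext1_zero B.
Proof.
move=> sip A0 D0 A' E i' p' sip' f; have [i_inj p_surj ex] := sip.
have [_ p'_surj ex'] := sip'.
have [W [h [q [sq exW jinj _]]]] := pullback_exists p' i.
have [j [sjq hj]] := ses_pullback sip' sq exW jinj.
have [g1 g1P] := A0 _ _ _ _ sjq f.
have sh : ses h (p \o p').
  split.
  - move=> w w' e; apply/eqP; rewrite -subr_eq0; apply/eqP.
    have h0 : h (w - w') = 0 by rewrite linearB e subrr.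
    by apply: jinj => //; apply: i_inj; rewrite -sq h0 !linear0.
  - move=> d; have [b pb] := p_surj d; have [u pu] := p'_surj b.
    by exists u => /=; rewrite pu.
  - move=> b /=; split=> [/ex[a ia]|[w <-]].
      by have [w [hw _]] := exW b a (esym ia); exists w.
    by rewrite sq (ses_comp0 _ sip).
have [g gP] := D0 _ _ _ _ sh g1.
by exists g => a; rewrite -hj gP g1P.
Qed.

(* The pullback W of p and p' is an extension of P' by K and contains K' as a
   direct factor. *)
Lemma ext_vanish_cover_aux n :
  (forall X Y (s : {linear X -> Y}) (r : {linear Y -> X}),
     (forall x, r (s x) = x) -> ext_vanish n Y -> ext_vanish n X) ->
  (forall A B D (i : {linear A -> B}) (p : {linear B -> D}),
     ses i p -> ext_vanish n A -> ext_vanish n D -> ext_vanish n B) ->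
  forall X K P (i : {linear K -> P}) (p : {linear P -> X}),
    projective P -> ses i p -> ext_vanish n K -> ext_vanish n.+1 X.
Proof.
move=> IHr IHe X K P i p Pp sip K0 K' P' i' p' P'p sip'.
have [W [h [q [sq ex jinj _]]]] := pullback_exists p p'.
have [j [sjq _]] := ses_pullback sip sq ex jinj.
have [k [skh _]] : exists k : {linear K' -> W}, ses k h /\ forall a, q (k a) = i' a.
  apply: (ses_pullback (f := p) sip') => [w|b y e|w ? ?]; [by rewrite sq| |exact: jinj].
  by have [w [? ?]] := ex _ _ (esym e); exists w.
have W0 := IHe _ _ _ _ _ sjq K0 (ext_vanish_projective n P'p).
by have [s [r [_ rk _]]] := ses_split Pp skh; exact: (IHr _ _ k r).
Qed.

(** The two closure properties are proved together, because passing from n to n + 1 uses the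
    independence of the cover, which needs both at level n. *)
Lemma ext_vanish_closure n :
  (forall X Y (s : {linear X -> Y}) (r : {linear Y -> X}),
     (forall x, r (s x) = x) -> ext_vanish n Y -> ext_vanish n X) /\
  (forall A B D (i : {linear A -> B}) (p : {linear B -> D}),
     ses i p -> ext_vanish n A -> ext_vanish n D -> ext_vanish n B).
Proof.
elim: n => [|n [IHr IHe]].
  by split; [exact: ext1_zero_retract | exact: ext1_zero_ses].
have one_cover := ext_vanish_cover_aux IHr IHe.
split=> [X Y s r rs Y0 K P i p Pp sip | A B D i p sip A0 D0].
  have [K' [F [i' [p' [Fp sip']]]]] := free_ses (submodule (lkernel r)).
  have [i_inj p_surj ex] := sip; have [i'_inj p'_surj ex'] := sip'.
  pose e : {linear submodule (lkernel r) -> Y} := \val.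
  have re v : r (e v) = 0 by exact/eqP/(valP v).
  (* Y is the sum of the image of [s] and the kernel of [r], so covers of X and of that kernel add
     up to a cover of Y; its kernel contains K as a retract. *)
  pose c := lcopair (s \o p) (e \o p').
  have c_surj y : exists x, c x = y.
    have ky : y - s (r y) \in lkernel r by rewrite inE linearB rs subrr.
    have [x px] := p_surj (r y); have [x' px'] := p'_surj (Submodule ky).
    by exists (x, x') => /=; rewrite px px' /= addrCA subrr addr0.
  have sK0 := ses_kernel c_surj.
  have K0 := Y0 _ _ _ _ (projective_pair Pp Fp) sK0.
  (* Naming and generalizing the inclusion keeps simplification from exposing the subtype. *)
  move: sK0; set k0 : {linear submodule (lkernel c) -> (P * F)%type} := \val.
  move: k0 => k0 sK0.
  have [k0_inj _ exK0] := sK0.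
  have [u uP] : exists u : {linear K -> submodule (lkernel c)},
      forall x, k0 (u x) = (linl P F \o i) x.
    apply: factor_inj => // x; apply/exK0 => /=.
    by rewrite (ses_comp0 _ sip) !linear0 addr0.
  have [v vP] : exists v : {linear submodule (lkernel c) -> K},
      forall x, i (v x) = (lfst P F \o k0) x.
    apply: factor_inj => // x; apply/ex => /=.
    have /(congr1 r) : c (k0 x) = 0 by apply/exK0; exists x.
    by rewrite /= linearD rs re addr0 linear0.
  by apply: (IHr _ _ u v) K0 => x; apply: i_inj; rewrite vP /= uP.
have [KA [PA [iA [pA [PAp sA]]]]] := free_ses A.
have [KD [PD [iD [pD [PDp sD]]]]] := free_ses D.
have [i_inj p_surj ex] := sip.
have [iA_inj pA_surj exA] := sA; have [iD_inj pD_surj exD] := sD.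
have [sg sgP] := PDp _ _ p pD p_surj.
(* Horseshoe construction: the covers of A and D give a cover of B whose kernel is an extension of
   KD by KA. *)
pose c := lcopair (i \o pA) sg.
have pc x y : p (c (x, y)) = pD y.
  by rewrite /= linearD (ses_comp0 _ sip) add0r sgP.
have c_surj b : exists x, c x = b.
  have [y py] := pD_surj (p b).
  have /ex[a ia] : p (b - sg y) = 0 by rewrite linearB sgP py subrr.
  by have [x px] := pA_surj a; exists (x, y) => /=; rewrite px ia subrK.
have sK0 := ses_kernel c_surj.
move: sK0; set k0 : {linear submodule (lkernel c) -> (PA * PD)%type} := \val.
move: k0 => k0 sK0.
have [k0_inj _ exK0] := sK0.
have [u uP] : exists u : {linear KA -> submodule (lkernel c)},
    forall x, k0 (u x) = (linl PA PD \o iA) x.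
  apply: factor_inj => // x; apply/exK0 => /=.
  by rewrite (ses_comp0 _ sA) !linear0 addr0.
have [v vP] : exists v : {linear submodule (lkernel c) -> KD},
    forall x, iD (v x) = (lsnd PA PD \o k0) x.
  apply: factor_inj => // x; apply/exD => /=.
  have : c (k0 x) = 0 by apply/exK0; exists x.
  by case: (k0 x) => a b cab; rewrite -(pc a) cab linear0.
have suv : ses u v.
  split.
  - move=> x y e; apply: iA_inj.
    by have := uP x; rewrite e uP => -[].
  - move=> d; have /ex[a ia] : p (sg (iD d)) = 0 by rewrite sgP (ses_comp0 _ sD).
    have [x px] := pA_surj a.
    have /exK0[w wP] : c (- x, iD d) = 0 by rewrite /= !linearN px ia addNr.
    by exists w; apply: iD_inj; rewrite vP /= wP.
  - move=> w; split=> [vw|[a <-]]; last first.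
      by apply: iD_inj; rewrite vP /= uP linear0.
    have := vP w; rewrite vw linear0 /= => w2.
    have : c (k0 w) = 0 by apply/exK0; exists w.
    rewrite /= -w2 linear0 addr0 => /eqP; rewrite -(linear0 i) => /eqP/i_inj/exA[a aP].
    exists a; apply: k0_inj; rewrite uP /= aP w2.
    by case: (k0 w).
apply: (one_cover _ _ _ _ _ (projective_pair PAp PDp) sK0).
by apply: (IHe _ _ _ _ _ suv); [exact: A0 sA | exact: D0 sD].
Qed.

Lemma ext_vanish_retract n X Y (s : {linear X -> Y}) (r : {linear Y -> X}) :
  (forall x, r (s x) = x) -> ext_vanish n Y -> ext_vanish n X.
Proof. by case: (ext_vanish_closure n) => H _; exact: H. Qed.

Lemma ext_vanish_ses n A B D (i : {linear A -> B}) (p : {linear B -> D}) :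
  ses i p -> ext_vanish n A -> ext_vanish n D -> ext_vanish n B.
Proof. by case: (ext_vanish_closure n) => _; exact. Qed.

Lemma ext_vanish_cover n X K P (i : {linear K -> P}) (p : {linear P -> X}) :
  projective P -> ses i p -> ext_vanish n K -> ext_vanish n.+1 X.
Proof.
by have [hr he] := ext_vanish_closure n; exact: ext_vanish_cover_aux hr he _ _ _ i p.
Qed.

(** One segment of the long exact sequence, obtained from the pullback W of B and a projective cover
    F of D. W is an extension of B by a syzygy of D, and it contains A as a summand because F is
    projective. *)
Lemma ext_vanish_shift n A B D (i : {linear A -> B}) (p : {linear B -> D}) :
  ses i p -> ext_vanish n B -> ext_vanish n.+1 D -> ext_vanish n A.
Proof.
move=> sip B0 D0; have [K [F [k [f [Fp skf]]]]] := free_ses D.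
have [W [h [q [sq ex jinj _]]]] := pullback_exists p f.
have [j [sjq _]] := ses_pullback sip sq ex jinj.
have [l [slh _]] : exists l : {linear K -> W}, ses l h /\ forall a, q (l a) = k a.
  apply: (ses_pullback (f := p) skf) => [w|b y e|w ? ?]; [by rewrite sq| |exact: jinj].
  by have [w [? ?]] := ex _ _ (esym e); exists w.
have W0 := ext_vanish_ses slh (D0 _ _ _ _ Fp skf) B0.
by have [s [r [_ rk _]]] := ses_split Fp sjq; exact: ext_vanish_retract rk W0.
Qed.

(** A single projective cover tests all extensions: any B over X is a quotient of A + P, and [f] and
    [g] agree on the relations coming from K. *)
Lemma ext1_zero_cover X K P (i : {linear K -> P}) (p : {linear P -> X}) :
  projective P -> ses i p ->
  (forall f : {linear K -> C}, exists g : {linear P -> C}, forall a, g (i a) = f a) ->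
  ext1_zero X.
Proof.
move=> Pp sip H A B j q sjq f; have [j_inj q_surj exj] := sjq.
have [i_inj p_surj exi] := sip.
have [sg sgP] := Pp _ _ q p q_surj.
have [k kP] : exists k : {linear K -> A}, forall x, j (k x) = (sg \o i) x.
  by apply: factor_inj => // x; apply/exj; rewrite /= sgP (ses_comp0 _ sip).
have [g gP] := H (f \o k).
have [G GP] : exists G : {linear B -> C}, forall u, G (lcopair j sg u) = lcopair f g u.
  apply: factor_surj => [b|[a x] /= e].
    have [x px] := p_surj (q b).
    have /exj[a ja] : q (b - sg x) = 0 by rewrite linearB sgP px subrr.
    by exists (a, x) => /=; rewrite ja subrK.
  have /exi[y yP] : p x = 0.
    by rewrite -sgP -[RHS](linear0 q) -e linearD (ses_comp0 _ sjq) add0r.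
  have -> : a = - k y.
    by apply: j_inj; rewrite linearN kP /= yP; apply/eqP; rewrite -addr_eq0 e.
  by rewrite -yP gP /= linearN addNr.
exists G => a; have := GP (a, 0) => /=.
by rewrite !linear0 !addr0.
Qed.

Definition acyclic X : Prop := forall n, ext_vanish n X.

Lemma acyclic_projective P : projective P -> acyclic P.
Proof. by move=> Pp n; exact: ext_vanish_projective. Qed.

End ExtVanish.

(** * Classes in Ext as cocycles modulo coboundaries *)

Section ExtOfElements.
Variables (R : comNzRingType) (X C : lmodType R) (G : resolution X).

Lemma coboundaryP j (z : {linear res_obj G j.+1 -> C}) :
  z \in coboundaries G C j.+1 <->
  exists g : {linear res_obj G j -> C}, forall x, z x = g (res_d G j x).
Proof.
split=> [/asboolP[g]|[g gE]].
  move=> e; have {}e : hom_pre C (res_d G j) g = z := e.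
  by exists g => x; rewrite -(linear_congr e x).
by apply/asboolP; exists g; apply: linear_ext => x; rewrite gE.
Qed.

Lemma cocycleP j (z : {linear res_obj G j -> C}) :
  z \in cocycles G C j <-> forall y, z (res_d G j y) = 0.
Proof.
split=> [/eqP e y|zd]; last by apply/eqP/linear_ext.
have {}e : hom_pre C (res_d G j) z = lin_zero _ _ := e.
by rewrite -[LHS]/(hom_pre C (res_d G j) z y) e.
Qed.

Lemma Ext_of_zeroP j :
  is_zero (Ext_of G C j.+1) <->
  forall z : {linear res_obj G j.+1 -> C}, (forall y, z (res_d G j.+1 y) = 0) ->
    exists g : {linear res_obj G j -> C}, forall x, z x = g (res_d G j x).
Proof.
split=> [E0 z /cocycleP zc|H x].
  have /eqP := E0 (quotmod_pi _ (Submodule zc)).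
  rewrite quotmod_pi_eq0.
  by move/(coboundaryP z).
rewrite -(quotmod_piK x); case: (repr x) => z zc.
apply/eqP; rewrite quotmod_pi_eq0.
exact/coboundaryP/H/cocycleP.
Qed.

Lemma Ext_of_associatedP j (p : prime_idealr R) :
  is_associated p (Ext_of G C j.+1) <->
  exists2 z : {linear res_obj G j.+1 -> C}, (forall y, z (res_d G j.+1 y) = 0) &
    forall a, a \in (p : {pred R}) <->
    exists g : {linear res_obj G j -> C}, forall x, a *: z x = g (res_d G j x).
Proof.
have key z (zc : z \in cocycles G C j.+1) a :
    a *: (quotmod_pi _ (Submodule zc) : Ext_of G C j.+1) == 0 <->
    exists g : {linear res_obj G j -> C}, forall x, a *: z x = g (res_d G j x).
  rewrite quotmod_piZ quotmod_pi_eq0.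
  exact: (coboundaryP (lin_scale a z)).
split=> [[x xP]|[z zd zP]].
  move: xP; rewrite -(quotmod_piK x); case: (repr x) => z zc xP; exists z.
    exact/cocycleP.
  by move=> a; rewrite xP; exact: key.
have zc : z \in cocycles G C j.+1 by apply/cocycleP.
exists (quotmod_pi _ (Submodule zc)) => a; apply/idP/idP.
  by move/zP/(key z zc).
by move/(key z zc)/zP.
Qed.

End ExtOfElements.

Section Acyclic.
Variables (R : comNzRingType) (C : lmodType R).
Implicit Types X Y : lmodType R.

(** All syzygies are treated at once: Ext^1 of the m-th syzygy is Ext^(m+1) of X, and each further
    degree is moved to the next syzygy. *)
Lemma Ext_zero_acyclic X :
  (forall i, (1 <= i)%N -> is_zero (Ext i X C)) -> acyclic C X.
Proof.
move=> E0 n; suff: forall m, ext_vanish C n (syzygy X m) by move/(_ 0%N).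
have sm m : ses (\val : {linear syzygy X m.+1 -> _}) (@free_cover R (syzygy X m)).
  exact/ses_kernel/free_cover_surj.
elim: n => [|n IHn] m; last first.
  exact: (ext_vanish_cover (@freeg_projective _ _) (sm m) (IHn m.+1)).
apply: (ext1_zero_cover (@freeg_projective _ _) (sm m)) => f.
have /Ext_of_zeroP/(_ (f \o @free_cover R (syzygy X m.+1))) := E0 m.+1 isT.
case=> [y|g gE].
  have dy : free_cover (std_d X m.+1 y) = 0 by apply/std_d_exact; exists y.
  by rewrite -[LHS]/(f (free_cover (std_d X m.+1 y))) dy linear0.
by exists g => a; have [y <-] := free_cover_surj a; have /= -> := gE y.
Qed.

(** The image B n of [D n] is acyclic by dimension shifting from B 0 = X 0. A map killed by [D n.+1]
    factors through B n, and for n > 0 it extends to X n because Ext^1 of the preceding image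
    vanishes. *)
Lemma exact_hom (X : nat -> lmodType R) (D : forall n, {linear X n.+1 -> X n}) :
  (forall x, exists y, D 0 y = x) ->
  (forall n x, D n x = 0 <-> exists y, D n.+1 y = x) ->
  (forall n, acyclic C (X n)) ->
  forall n (f : {linear X n.+1 -> C}), (forall y, f (D n.+1 y) = 0) ->
    exists g : {linear X n -> C}, forall x, f x = g (D n x).
Proof.
move=> D_surj D_ex Xac.
pose B n := submodule (limage (D n)).
pose v n : {linear B n -> X n} := \val.
have v_inj n : injective (v n) by exact: val_inj.
have e_ex n : exists e : {linear X n.+1 -> B n}, forall x, v n (e x) = D n x.
  apply: factor_inj => // x.
  have Bx : D n x \in limage (D n) by apply/asboolP; exists x.
  by exists (Submodule Bx).
have vP n (b : B n) : exists x, D n x = v n b by have /asboolP := valP b.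
have s n : exists2 e : {linear X n.+1 -> B n}, forall x, v n (e x) = D n x & ses (v n.+1) e.
  have [e eP] := e_ex n; exists e => //; split=> //.
    by move=> b; have [x xP] := vP n b; exists x; apply: v_inj; rewrite eP.
  have e0 x : e x = 0 <-> D n x = 0.
    by rewrite -eP; split=> [->|ex0]; rewrite ?linear0 //; apply: v_inj; rewrite linear0.
  move=> x; split=> [/e0/D_ex[y yx]|[b <-]].
    by have [e' e'P] := e_ex n.+1; exists (e' y); rewrite e'P.
  by apply/e0/D_ex; exact: vP.
have [r rP] : exists r : {linear X 0 -> B 0}, forall x, v 0 (r x) = (idfun : {linear X 0 -> X 0}) x.
  apply: factor_inj => // x.
  have Bx : x \in limage (D 0%N) by apply/asboolP; exact: D_surj.
  by exists (Submodule Bx).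
have rv b : r (v 0 b) = b by apply: v_inj; rewrite rP.
have Bac n : acyclic C (B n).
  elim: n => [|n IHn] m; first exact: (ext_vanish_retract rv (Xac 0%N m)).
  by have [e _ se] := s n; apply: (ext_vanish_shift se); [exact: Xac | exact: IHn].
move=> n f fD; have [e eP [_ e_surj e_ker]] := s n.
have [h hP] : exists h : {linear B n -> C}, forall x, h (e x) = f x.
  apply: factor_surj => // x /(congr1 (v n)).
  by rewrite eP linear0 => /D_ex[y <-].
case: n f fD e eP e_surj e_ker h hP => [|n] f fD e eP e_surj e_ker h hP.
  by exists (h \o r) => x /=; rewrite -hP -eP rv.
have [e' e'P se'] := s n.
have [g gP] := Bac n 0 _ _ _ _ se' h.
by exists g => x; rewrite -hP -gP eP.
Qed.

End Acyclic.

(** The types vary with n, as for the components of a chain map; the invariant [good] guarantees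
    that each choice can be continued. *)
Lemma dependent_nat_choice (A : nat -> Type) (good : forall n, A n -> Prop)
    (rel : forall n, A n -> A n.+1 -> Prop) (x0 : A 0%N) :
  good 0%N x0 ->
  (forall n x, good n x -> exists y, good n.+1 y /\ rel n x y) ->
  exists f : forall n, A n, f 0%N = x0 /\ forall n, rel n (f n) (f n.+1).
Proof.
move=> g0 step.
pose next n (x : {x : A n | good n x}) : {y : A n.+1 | good n.+1 y} :=
  let y := cid (step n (sval x) (svalP x)) in exist _ (sval y) (svalP y).1.
pose f := fix f n : {x : A n | good n x} :=
  match n with 0 => exist _ x0 g0 | m.+1 => next m (f m) end.
exists (fun n => sval (f n)); split=> // n /=.
by case: (cid _) => y [].
Qed.

(** * Ext computed from a resolution by acyclic modules *)

Section Comparison.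
Variables (R : comNzRingType) (T C : lmodType R) (G : resolution T).
Variables (Q : nat -> lmodType R) (q : forall n, {linear Q n.+1 -> Q n}).
Variable eps : {linear Q 0%N -> T}.
Hypothesis eps_surj : forall x, exists y, eps y = x.
Hypothesis eps_exact : forall x, eps x = 0 <-> exists y, q 0 y = x.
Hypothesis q_exact : forall n x, q n x = 0 <-> exists y, q n.+1 y = x.
Hypothesis Q_acyclic : forall n, acyclic C (Q n).

Let d n : {linear res_obj G n.+1 -> res_obj G n} := res_d G n.

Let dd n x : d n (d n.+1 x) = 0.
Proof. by apply/res_exact; exists x. Qed.
Let qq n x : q n (q n.+1 x) = 0.
Proof. by apply/q_exact; exists x. Qed.

Lemma chain_map_exists :
  exists phi : forall n, {linear res_obj G n -> Q n},
    (forall x, eps (phi 0%N x) = res_aug G x) /\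
    forall n x, q n (phi n.+1 x) = phi n (d n x).
Proof.
have [phi0 phi0P] := @res_projective _ _ G 0 _ _ eps (res_aug G) eps_surj.
pose good n (f : {linear res_obj G n -> Q n}) :=
  forall y, exists w, q n w = f (d n y).
pose rel n (f : {linear res_obj G n -> Q n}) (f' : {linear res_obj G n.+1 -> Q n.+1}) :=
  forall x, q n (f' x) = f (d n x).
have [||phi [phi00 phiP]] := @dependent_nat_choice _ good rel phi0.
- move=> y; apply/eps_exact; rewrite phi0P.
  by apply/res_exact0; exists y.
- move=> n f gf.
  have [f' f'P] := projective_lift (e := q n) (f := f \o d n) (@res_projective _ _ G n.+1) gf.
  exists f'; split=> // y; apply/q_exact.
  by rewrite f'P /= dd linear0.
- by exists phi; split=> // x; rewrite phi00.
Qed.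

Section Cone.
Variable phi : forall n, {linear res_obj G n -> Q n}.
Hypothesis phi_aug : forall x, eps (phi 0%N x) = res_aug G x.
Hypothesis phi_comm : forall n x, q n (phi n.+1 x) = phi n (d n x).

(** Mapping cone of [phi]. It is exact since both complexes resolve T, and its terms are acyclic, so
    it stays exact under Hom(-, C); this makes [phi] an isomorphism on cohomology. *)
Definition cone (n : nat) : lmodType R :=
  match n with
  | 0 => Q 0%N
  | m.+1 => (res_obj G m * Q m.+1)%type
  end.

Definition cone_d (n : nat) : {linear cone n.+1 -> cone n} :=
  match n with
  | 0 => lcopair (phi 0%N) (q 0%N)
  | m.+1 => lpair (\- (d m \o lfst (res_obj G m.+1) (Q m.+2)))
                  (lcopair (phi m.+1) (q m.+1))
  end.

Lemma cone_surj x : exists y, cone_d 0 y = x.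
Proof.
have [p pP] := @res_aug_surj _ _ G (eps x).
have /eps_exact[y yP] : eps (x - phi 0%N p) = 0 by rewrite linearB phi_aug pP subrr.
by exists (p, y); rewrite /= yP addrC subrK.
Qed.

Lemma cone_exact n x : cone_d n x = 0 <-> exists y, cone_d n.+1 y = x.
Proof.
suff key p y : (exists w, d n w = p) -> phi n p + q n y = 0 ->
    exists w : res_obj G n.+1 * Q n.+2, (- d n w.1, phi n.+1 w.1 + q n.+1 w.2) = (p, y).
  case: n x key => [|n] [p y] key; split.
  - move=> /= e; apply: key => //; apply/res_exact0.
    have epsq : eps (q 0%N y) = 0 by apply/eps_exact; exists y.
    by rewrite -phi_aug -[LHS]addr0 -epsq -linearD e linear0.
  - move=> [[u v] [<- <-]] /=.
    by rewrite linearN linearD phi_comm qq addr0 addNr.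
  - move=> [/eqP]; rewrite oppr_eq0 => /eqP dp e; apply: key => //.
    exact/res_exact.
  - move=> [[u v] [<- <-]] /=.
    rewrite [d n _]linearN dd opprK.
    by rewrite linearN linearD phi_comm qq addr0 addNr.
move=> [u up] e.
have /q_exact[v vP] : q n (y + phi n.+1 u) = 0.
  by rewrite linearD phi_comm up addrC.
by exists (- u, v); rewrite /= !linearN opprK up vP addrC addrK.
Qed.

Lemma cone_acyclic n : acyclic C (cone n).
Proof.
case: n => [|n] //= m.
apply: (ext_vanish_ses (ses_pair _ _)); last exact: Q_acyclic.
exact/ext_vanish_projective/res_projective.
Qed.

(** The pair (z, 0) is a cocycle on the cone; u and v are the two components of a cochain bounding
    it. *)
Lemma cohomology_surj i (z : {linear res_obj G i.+1 -> C}) :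
  (forall y, z (d i.+1 y) = 0) ->
  exists2 v : {linear Q i.+1 -> C}, (forall y, v (q i.+1 y) = 0) &
    exists u : {linear res_obj G i -> C}, forall x, z x = v (phi i.+1 x) - u (d i x).
Proof.
move=> zd.
have [[p y]|g gP] := exact_hom cone_surj cone_exact cone_acyclic
    (f := (z \o lfst _ _ : {linear cone i.+2 -> C})).
  by rewrite /= linearN zd oppr0.
exists (g \o linr _ _).
  by move=> y; have := gP (0, y); rewrite /= !linear0 add0r => <-.
exists (g \o linl _ _) => x; have := gP (x, 0); rewrite /= linear0 addr0 => ->.
by rewrite -linearB; congr (g (_, _)); rewrite /= ?sub0r ?subr0.
Qed.

(** The pair (u, z) is a cocycle on the cone, and b is the Q-component of a cochain bounding it. For
    i = 0 that cochain already lives on Q 0. *)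
Lemma cohomology_inj i (z : {linear Q i.+1 -> C}) (u : {linear res_obj G i -> C}) :
  (forall y, z (q i.+1 y) = 0) -> (forall x, z (phi i.+1 x) = u (d i x)) ->
  exists b : {linear Q i -> C}, forall y, z y = b (q i y).
Proof.
move=> zq zu.
have [[p y]|g gP] := exact_hom cone_surj cone_exact cone_acyclic
    (f := (lcopair u z : {linear cone i.+1 -> C})).
  by rewrite /= linearN linearD zu zq addr0 addNr.
case: i z u zq zu g gP => [|i] z u zq zu g gP.
  by exists g => y; have := gP (0, y); rewrite /= !linear0 !add0r.
exists (g \o linr _ _) => y.
by have := gP (0, y); rewrite /= !linear0 !add0r.
Qed.

End Cone.

Lemma Ext_of_acyclic_zeroP j :
  is_zero (Ext_of G C j.+1) <->
  forall z : {linear Q j.+1 -> C}, (forall y, z (q j.+1 y) = 0) ->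
    exists g : {linear Q j -> C}, forall x, z x = g (q j x).
Proof.
have [phi [phi_aug phi_comm]] := chain_map_exists; rewrite Ext_of_zeroP.
split=> H z zd.
  have [|g gP] := H (z \o phi j.+1); first by move=> y /=; rewrite -phi_comm zd.
  exact: (cohomology_inj phi_aug phi_comm zd gP).
have [v vq [u uP]] := cohomology_surj phi_aug phi_comm zd.
have [g gP] := H v vq.
by exists ((g \o phi j) \- u) => x; rewrite uP gP phi_comm.
Qed.

(** Surjectivity transports the class, and injectivity applied to all its multiples [a *: z] shows
    that its annihilator is unchanged. *)
Lemma Ext_of_acyclic_associatedP j (p : prime_idealr R) :
  is_associated p (Ext_of G C j.+1) <->
  exists2 z : {linear Q j.+1 -> C}, (forall y, z (q j.+1 y) = 0) &
    forall a, a \in (p : {pred R}) <->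
    exists g : {linear Q j -> C}, forall x, a *: z x = g (q j x).
Proof.
have [phi [phi_aug phi_comm]] := chain_map_exists; rewrite Ext_of_associatedP.
split=> -[z zd zP].
  have [v vq [u uP]] := cohomology_surj phi_aug phi_comm zd.
  exists v => // a; rewrite zP; split=> -[g gP].
    apply: (cohomology_inj phi_aug phi_comm (z := a \*: v) (u := g \+ a \*: u)).
      by move=> y /=; rewrite vq scaler0.
    by move=> x /=; rewrite -gP -scalerDr uP subrK.
  exists ((g \o phi j) \- a \*: u) => x /=.
  by rewrite uP scalerBr gP phi_comm.
exists (z \o phi j.+1); first by move=> y /=; rewrite -phi_comm zd.
move=> a; rewrite zP; split=> -[g gP].
  by exists (g \o phi j) => x /=; rewrite gP phi_comm.
apply: (cohomology_inj phi_aug phi_comm (z := a \*: z) (u := g)) => //.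
by move=> y /=; rewrite zd scaler0.
Qed.

End Comparison.

(** * Finitely generated modules over noetherian rings *)

Section FinitelyGenerated.
Variable R : comNzRingType.
Implicit Types A B D U V W P : lmodType R.

Lemma fg_surj U V (f : {linear U -> V}) :
  (forall v, exists u, f u = v) -> finitely_generated U -> finitely_generated V.
Proof.
move=> f_surj [n [g gP]]; exists n, (f \o g) => v.
have [u <-] := f_surj v; have [c ->] := gP u; exists c.
by rewrite linear_sum; apply: eq_bigr => i _; rewrite linearZ.
Qed.

Lemma fg_pair U V :
  finitely_generated U -> finitely_generated V -> finitely_generated (U * V)%type.
Proof.
move=> [n [g gP]] [m [h hP]].
exists (n + m)%N, (fun i => match split i with
  | inl j => linl U V (g j) | inr k => linr U V (h k) end) => -[u v].
have [c uE] := gP u; have [e vE] := hP v.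
exists (fun i => match split i with inl j => c j | inr k => e k end).
rewrite big_split_ord.
transitivity (linl U V u + linr U V v).
  by congr pair; rewrite /= ?addr0 ?add0r.
rewrite uE vE !linear_sum; congr (_ + _); apply: eq_bigr => i _.
  by rewrite (unsplitK (inl _ i)) linearZ.
by rewrite (unsplitK (inr _ i)) linearZ.
Qed.

Definition rV_comb n V (g : 'I_n -> V) (v : 'rV[R]_n) : V :=
  \sum_(i < n) v 0 i *: g i.

Lemma rV_comb_linear n V (g : 'I_n -> V) : linear (rV_comb g).
Proof.
move=> a x y; rewrite /rV_comb scaler_sumr -big_split; apply: eq_bigr => i _ /=.
by rewrite !mxE scalerDl scalerA.
Qed.

Lemma rV_projective n : projective 'rV[R]_n.
Proof.
move=> A B g f g_surj.
have [h hP] := choice (fun i : 'I_n => g_surj (f (delta_mx 0 i))).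
exists (mklinear (rV_comb_linear h)) => x /=.
rewrite /rV_comb linear_sum [in RHS](row_sum_delta x) linear_sum.
by apply: eq_bigr => i _; rewrite !linearZ /= hP.
Qed.

Lemma rV_cover V : finitely_generated V ->
  exists n (f : {linear 'rV[R]_n -> V}), forall v, exists u, f u = v.
Proof.
move=> [n [g gP]]; exists n, (mklinear (rV_comb_linear g)) => v.
have [c ->] := gP v; exists (\row_i c i) => /=.
by apply: eq_bigr => i _; rewrite mxE.
Qed.

Lemma rV_fg n : finitely_generated 'rV[R]_n.
Proof.
exists n, (fun i => delta_mx 0 i) => x; exists (fun i => x 0 i).
exact: row_sum_delta.
Qed.

Lemma fg_ses A B D (i : {linear A -> B}) (p : {linear B -> D}) :
  ses i p -> finitely_generated A -> finitely_generated D -> finitely_generated B.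
Proof.
move=> [_ p_surj ex] fgA fgD; have [n [f f_surj]] := rV_cover fgD.
have [g gP] := rV_projective f p_surj.
apply: (fg_surj (f := lcopair i g)) (fg_pair fgA (rV_fg n)) => b.
have [x fx] := f_surj (p b).
have /ex[a ia] : p (b - g x) = 0 by rewrite linearB gP fx subrr.
by exists (a, x); rewrite /= ia subrK.
Qed.

Definition noetherian_module V : Prop :=
  forall U : submod V, finitely_generated (submodule U).

Lemma noetherian_module_surj U V (f : {linear U -> V}) :
  (forall v, exists u, f u = v) -> noetherian_module U -> noetherian_module V.
Proof.
move=> f_surj noethU S.
have [g gP] : exists g : {linear submodule (lpreimage f S) -> submodule S},
    forall x, val (g x) = (f \o \val) x.
  apply: factor_inj; first exact: val_inj.
  by move=> x; exists (Submodule (valP x : f (val x) \in S)).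
apply: (fg_surj (f := g)) (noethU _) => v.
have [u fu] := f_surj (val v).
have Su : u \in lpreimage f S by rewrite inE fu; exact: (valP v).
by exists (Submodule Su); apply: val_inj; rewrite gP.
Qed.

Lemma noetherian_module_ses A B D (i : {linear A -> B}) (p : {linear B -> D}) :
  ses i p -> noetherian_module A -> noetherian_module D -> noetherian_module B.
Proof.
move=> [i_inj p_surj ex] noethA noethD S.
pose v : {linear submodule S -> B} := \val.
have v_inj : injective v by exact: val_inj.
have vS x : v x \in S by exact: (valP x).
have vP b : b \in S -> exists x, v x = b by move=> Sb; exists (Submodule Sb).
pose vA : {linear submodule (lpreimage i S) -> A} := \val.
have vA_inj : injective vA by exact: val_inj.
have vAS x : i (vA x) \in S by exact: (valP x).
have vAP a : i a \in S -> exists x, vA x = a by move=> Sa; exists (Submodule (Sa : a \in lpreimage i S)).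
pose vD : {linear submodule (limage (p \o v)) -> D} := \val.
have vD_inj : injective vD by exact: val_inj.
have vDS x : exists y, p (v y) = vD x by have /asboolP := valP x.
have vDP y : exists x, vD x = p (v y).
  have Sy : p (v y) \in limage (p \o v) by apply/asboolP; exists y.
  by exists (Submodule Sy).
(* The three inclusions become opaque; only their listed properties are used below. *)
move: v v_inj vS vP vA vA_inj vAS vAP vD vD_inj vDS vDP.
move=> v v_inj vS vP vA vA_inj vAS vAP vD vD_inj vDS vDP.
have [j jP] : exists j : {linear submodule (lpreimage i S) -> submodule S},
    forall x, v (j x) = (i \o vA) x.
  by apply: factor_inj => // x; exact: vP (vAS x).
have [r rP] : exists r : {linear submodule S -> submodule (limage (p \o v))},
    forall x, vD (r x) = (p \o v) x.
  by apply: factor_inj.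
apply: (fg_ses (i := j) (p := r)) (noethA _) (noethD _); split.
- by move=> x y /(congr1 v); rewrite !jP => /i_inj/vA_inj.
- by move=> x; have [y yx] := vDS x; exists y; apply: vD_inj; rewrite rP.
- move=> x; split=> [/(congr1 vD)|[y <-]].
    rewrite rP linear0 => /ex[a ia].
    have [|y ya] := vAP a; first by rewrite ia.
    by exists y; apply: v_inj; rewrite jP /= ya.
  by apply: vD_inj; rewrite rP linear0 /= jP; apply/ex; exists (vA y).
Qed.

(** Iterated pairs ending in the zero module let inductions run through [ses_pair]. *)
Fixpoint lpower U (n : nat) : lmodType R :=
  match n with
  | 0 => 'rV[R]_0
  | m.+1 => (U * lpower U m)%type
  end.

Lemma noetherian_lpower U n :
  noetherian_module U -> noetherian_module (lpower U n).
Proof.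
move=> noethU; elim: n => [|n IHn] /=; last first.
  exact: noetherian_module_ses (ses_pair _ _) noethU IHn.
move=> S; exists 0%N, (fun=> 0) => x; exists (fun=> 0).
by rewrite big_ord0; apply: val_inj; exact: thinmx0.
Qed.

(* V is a direct summand of a finite direct sum of copies of U. *)
Definition in_add U V : Prop :=
  exists n (i : 'I_n -> {linear U -> V}) (p : 'I_n -> {linear V -> U}),
    forall v, v = \sum_(k < n) i k (p k v).

Lemma in_add_lpower U V : in_add U V ->
  exists n (s : {linear V -> lpower U n}) (r : {linear lpower U n -> V}),
    forall v, r (s v) = v.
Proof.
move=> [n [i [p ipP]]]; exists n.
suff [s [r rs]] : exists (s : {linear V -> lpower U n})
    (r : {linear lpower U n -> V}), forall v, r (s v) = \sum_(k < n) i k (p k v).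
  by exists s, r => v; rewrite rs -ipP.
elim: n i p {ipP} => [|n IHn] i p.
  by exists \0, \0 => v; rewrite big_ord0.
have [s [r rs]] := IHn (i \o lift ord0) (p \o lift ord0).
exists (lpair (p ord0) s), (lcopair (i ord0) r) => v.
by rewrite big_ord_recl /= rs.
Qed.

Lemma in_add_retract U V W (s : {linear V -> W}) (r : {linear W -> V}) :
  (forall v, r (s v) = v) -> in_add U W -> in_add U V.
Proof.
move=> rs [n [i [p ipP]]]; exists n, (fun k => r \o i k), (fun k => p k \o s) => v.
by rewrite -[LHS]rs [s v]ipP linear_sum.
Qed.

Lemma rV_in_add n : in_add R^o 'rV[R]_n.
Proof.
have i_lin k : linear (fun r : R^o => r *: delta_mx 0 k : 'rV[R]_n).
  by move=> a x y; rewrite scalerDl scalerA.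
have p_lin k : linear (fun v : 'rV[R]_n => v 0 k : R^o).
  by move=> a x y; rewrite !mxE.
exists n, (fun k => mklinear (i_lin k)), (fun k => mklinear (p_lin k)) => v.
exact: row_sum_delta.
Qed.

Lemma fg_projective_in_add P :
  finitely_generated P -> projective P -> in_add R^o P.
Proof.
move=> /rV_cover[n [f f_surj]] Pp; have [s sP] := Pp _ _ f idfun f_surj.
exact: in_add_retract sP (rV_in_add n).
Qed.

Lemma fg_noetherian V : noetherian R -> finitely_generated V -> noetherian_module V.
Proof.
move=> noethR /rV_cover[n [f f_surj]]; apply: (noetherian_module_surj f_surj).
have [m [s [r rs]]] := in_add_lpower (rV_in_add n).
apply: (noetherian_module_surj (f := r)); first by move=> v; exists (s v).
exact: noetherian_lpower.
Qed.

Lemma in_add_fg U V : finitely_generated U -> in_add U V -> finitely_generated V.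
Proof.
move=> fgU /in_add_lpower[n [s [r rs]]].
apply: (fg_surj (f := r)); first by move=> v; exists (s v).
elim: n {s r rs} => [|n IHn]; first exact: rV_fg.
exact: fg_pair.
Qed.

Lemma in_add_acyclic C U V : acyclic C U -> in_add U V -> acyclic C V.
Proof.
move=> Uac /in_add_lpower[n [s [r rs]]] m.
apply: (ext_vanish_retract rs).
elim: n {s r rs} => [|n IHn]; first exact/ext_vanish_projective/rV_projective.
exact: (ext_vanish_ses (ses_pair _ _)).
Qed.

Lemma kernel_cover V W (u : {linear V -> W}) : noetherian_module V ->
  exists m (e : {linear 'rV[R]_m -> V}), forall x, u x = 0 <-> exists y, e y = x.
Proof.
move=> noethV; have [m [e e_surj]] := rV_cover (noethV (lkernel u)).
exists m, (\val \o e) => x; split=> [ux|[y <-]]; last exact/eqP/(valP (e y)).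
have kx : x \in lkernel u by apply/eqP.
by have [y yx] := e_surj (Submodule kx); exists y; rewrite /= yx.
Qed.

End FinitelyGenerated.

(** * Biduality of finitely generated projective modules *)

Section Bidual.
Variables (R : comNzRingType) (C : lmodType R).
Implicit Types P : lmodType R.

Lemma tensor_hom_linear P (p : {linear P -> R^o}) (c : C) :
  linear (fun x => (p x : R) *: c).
Proof. by move=> a x y; rewrite linearP scalerDl scalerA. Qed.
(** The image of p tensor c under the natural map from Hom(P, R) tensor C to Hom(P, C). *)
Definition tensor_hom P (p : {linear P -> R^o}) (c : C) : {linear P -> C} :=
  mklinear (tensor_hom_linear p c).

Lemma tensor_homr_linear P (p : {linear P -> R^o}) : linear (tensor_hom p).
Proof.
move=> a c c'; apply: linear_ext => x /=.
by rewrite scalerDr !scalerA mulrC.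
Qed.

Lemma hom_eval_linear P (x : P) : linear (fun f : {linear P -> C} => f x).
Proof. by []. Qed.
Definition hom_eval P (x : P) : {linear {linear P -> C} -> C} :=
  mklinear (hom_eval_linear x).

Lemma hom_expand P n (i : 'I_n -> {linear R^o -> P}) (p : 'I_n -> {linear P -> R^o}) :
  (forall v, v = \sum_(k < n) i k (p k v)) ->
  forall f : {linear P -> C}, f = \sum_(k < n) tensor_hom (p k) (f (i k 1)).
Proof.
move=> ipP f; apply: linear_ext => x.
transitivity (hom_eval x (\sum_(k < n) tensor_hom (p k) (f (i k 1)))); last by [].
rewrite linear_sum [in LHS](ipP x) linear_sum; apply: eq_bigr => k _ /=.
by rewrite -!linearZ /= -[in LHS](mulr1 (p k x)).
Qed.

Lemma hom_in_add P : in_add R^o P -> in_add C {linear P -> C}.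
Proof.
move=> [n [i [p ipP]]].
exists n, (fun k => mklinear (tensor_homr_linear (p k))), (fun k => hom_eval (i k 1)).
by move=> f; exact: hom_expand.
Qed.

(** Testing on the maps [tensor_hom (p k) c] shows that each coordinate of x acts as zero on C. *)
Lemma hom_eval_inj P : injective (homothety C) -> in_add R^o P ->
  forall x : P, (forall f : {linear P -> C}, f x = 0) -> x = 0.
Proof.
move=> h_inj [n [i [p ipP]]] x fx; rewrite [x]ipP big1 // => k _.
suff -> : p k x = 0 by rewrite linear0.
apply: h_inj; apply: linear_ext => c /=.
by rewrite scale0r; have := fx (tensor_hom (p k) c).
Qed.

(** Composing F with the k-th map from C to Hom(P, C) gives an endomorphism of C, hence a scalar;
    these scalars are the coordinates of the point sought. *)
Lemma hom_eval_surj P : (forall f : {linear C -> C}, exists r, homothety C r = f) ->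
  in_add R^o P ->
  forall F : {linear {linear P -> C} -> C}, exists x : P, forall f, F f = f x.
Proof.
move=> h_surj [n [i [p ipP]]] F.
have [r rP] := choice (fun k => h_surj (F \o mklinear (tensor_homr_linear (p k)))).
exists (\sum_(k < n) i k (r k)) => f.
rewrite [in LHS](hom_expand ipP f) !linear_sum; apply: eq_bigr => k _.
have /= <- := linear_congr (rP k) (f (i k 1)).
by rewrite -!linearZ /= -[in RHS](mulr1 (r k)).
Qed.

End Bidual.

(** * A complex computing Ext(Tr M, C) *)

Section Complexes.
Variables (R : comNzRingType) (K : nat -> lmodType R).
Variable dK : forall n, {linear K n -> K n.+1}.

Definition boundaries (n : nat) : submod (K n) :=
  match n with
  | 0 => submod0 _
  | m.+1 => limage (dK m)
  end.

Definition cohomology_zero (n : nat) : Prop :=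
  forall z, dK n z = 0 -> z \in boundaries n.

Definition cohomology_associated (p : prime_idealr R) (n : nat) : Prop :=
  exists2 z, dK n z = 0 & forall a, (a \in (p : {pred R})) = (a *: z \in boundaries n).
End Complexes.

Section AugmentedComplex.
Variables (R : comNzRingType) (M : lmodType R) (K : nat -> lmodType R).
Variables (d : {linear M -> K 0%N}) (dK : forall n, {linear K n -> K n.+1}).

Definition aug_obj (n : nat) : lmodType R :=
  match n with
  | 0 => M
  | m.+1 => K m
  end.

Definition aug_d (n : nat) : {linear aug_obj n -> aug_obj n.+1} :=
  match n with
  | 0 => d
  | m.+1 => dK m
  end.
End AugmentedComplex.

Lemma free_resolution_exists (R : comNzRingType) (V W : lmodType R)
    (u : {linear V -> W}) : noetherian R -> noetherian_module V ->
  exists (m : nat -> nat) (e0 : {linear 'rV[R]_(m 0%N) -> V})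
         (e : forall n, {linear 'rV[R]_(m n.+1) -> 'rV[R]_(m n)}),
  [/\ forall x, u x = 0 <-> exists y, e0 y = x,
      forall x, e0 x = 0 <-> exists y, e 0%N y = x &
      forall n x, e n x = 0 <-> exists y, e n.+1 y = x].
Proof.
move=> noethR noethV; have [m0 [e0 e0P]] := kernel_cover u noethV.
(* The target is V at first and a free module afterwards, so the recursion carries size, target and
   map together. *)
pose T := {m : nat & {X : lmodType R & {linear 'rV[R]_m -> X}}}.
pose mk m (X : lmodType R) (f : {linear 'rV[R]_m -> X}) : T := existT _ m (existT _ X f).
pose mp (s : T) : {linear 'rV[R]_(projT1 s) -> projT1 (projT2 s)} :=
  projT2 (projT2 s).
have next (s : T) : {m : nat & {e : {linear 'rV[R]_m -> 'rV[R]_(projT1 s)} |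
    forall x, mp s x = 0 <-> exists y, e y = x}}.
  have /cid[m /cid[e eP]] := kernel_cover (mp s)
    (fg_noetherian noethR (rV_fg _ (projT1 s))).
  by exists m, e.
have [N [D DP]] : exists (N : T -> nat)
    (D : forall s, {linear 'rV[R]_(N s) -> 'rV[R]_(projT1 s)}),
    forall s x, mp s x = 0 <-> exists y, D s y = x.
  exists (fun s => projT1 (next s)), (fun s => sval (projT2 (next s))) => s.
  exact: (svalP (projT2 (next s))).
pose st := fix st n : T := match n with
  | 0 => mk m0 V e0
  | k.+1 => mk (N (st k)) _ (D (st k))
  end.
exists (fun n => projT1 (st n)), e0, (fun n => D (st n)); split=> // [x|n x].
  exact: (DP (st 0%N)).
exact: (DP (st n.+1)).
Qed.

Section TransposeComplex.
Variables (R : comNzRingType) (M C P0 P1 : lmodType R).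
Variables (d1 : {linear P1 -> P0}) (d0 : {linear P0 -> M}).
Hypothesis noethR : noetherian R.
Hypothesis sdC : semidualizing C.
Hypothesis presM : fg_proj_presentation d1 d0.

Let C_fg : finitely_generated C. Proof. by case: sdC. Qed.
Let C_acyclic : acyclic C C.
Proof. by case: sdC => _ _; exact: Ext_zero_acyclic. Qed.
Let homothety_inj : injective (homothety C).
Proof. by case: sdC => _ /bij_inj. Qed.
Let homothety_surj (f : {linear C -> C}) : exists r, homothety C r = f.
Proof. by case: sdC => _ [g _ gK] _; exists (g f). Qed.
Let P0_add : in_add R^o P0.
Proof. by case: presM => -[? ?] _ _ _; exact: fg_projective_in_add. Qed.
Let P1_add : in_add R^o P1.
Proof. by case: presM => _ [? ?] _ _; exact: fg_projective_in_add. Qed.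
Let d0_surj m : exists x, d0 x = m.
Proof. by case: presM. Qed.
Let d0_exact x : d0 x = 0 <-> exists y, d1 y = x.
Proof. by case: presM. Qed.

Variables (m : nat -> nat) (e0 : {linear 'rV[R]_(m 0%N) -> {linear P0 -> C}}).
Variable e : forall n, {linear 'rV[R]_(m n.+1) -> 'rV[R]_(m n)}.
Hypothesis e0_exact : forall f, hom_pre C d1 f = 0 <-> exists y, e0 y = f.
Hypothesis e_exact0 : forall x, e0 x = 0 <-> exists y, e 0%N y = x.
Hypothesis e_exact : forall n x, e n x = 0 <-> exists y, e n.+1 y = x.

(* The resolution ... -> R^(m_1) -> R^(m_0) -> Hom(P0, C) -> Hom(P1, C) of Tr. *)
Definition tr_res_obj (n : nat) : lmodType R :=
  match n with
  | 0 => {linear P1 -> C}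
  | 1 => {linear P0 -> C}
  | k.+2 => 'rV[R]_(m k)
  end.

Definition tr_res_d (n : nat) : {linear tr_res_obj n.+1 -> tr_res_obj n} :=
  match n with
  | 0 => hom_pre C d1
  | 1 => e0
  | k.+2 => e k
  end.

Lemma tr_res_exact n x : tr_res_d n x = 0 <-> exists y, tr_res_d n.+1 y = x.
Proof.
by case: n x => [|[|n]] x; [exact: e0_exact | exact: e_exact0 | exact: e_exact].
Qed.

Lemma tr_res_acyclic n : acyclic C (tr_res_obj n).
Proof.
case: n => [|[|n]]; try exact/(in_add_acyclic C_acyclic)/hom_in_add.
exact/acyclic_projective/rV_projective.
Qed.

Definition tr_eps : {linear tr_res_obj 0 -> Tr C d1} := quotmod_pi _.

Lemma tr_eps_surj x : exists y, tr_eps y = x.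
Proof. by exists (repr x); exact: quotmod_piK. Qed.

Lemma tr_eps_exact x : tr_eps x = 0 <-> exists y, tr_res_d 0 y = x.
Proof.
by split=> [/eqP|xP]; [|apply/eqP]; rewrite quotmod_pi_eq0; [move/asboolP|apply/asboolP].
Qed.

Let K n : lmodType R := {linear tr_res_obj n.+2 -> C}.
Let dK n : {linear K n -> K n.+1} := hom_pre C (tr_res_d n.+2).
Variable d : {linear M -> K 0%N}.
Hypothesis dE : forall x u, d (d0 x) u = tr_res_d 1 u x.

Let qq n x : tr_res_d n (tr_res_d n.+1 x) = 0.
Proof. by apply/tr_res_exact; exists x. Qed.

Lemma tr_complex_sq0 n x : aug_d d dK n.+1 (aug_d d dK n x) = 0.
Proof.
case: n x => [|n] x; apply: linear_ext => u; last first.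
  by rewrite -[LHS]/(x (tr_res_d n.+2 (tr_res_d n.+3 u))) qq linear0.
by have [y <-] := d0_surj x; rewrite -[LHS]/(d (d0 y) (tr_res_d 2 u)) dE qq.
Qed.

(** By biduality g is evaluation at some y in P1, so evaluation at x is a coboundary exactly when x
    is in the image of [d1]. Degree 0 of the complex is thereby M instead of P0. *)
Lemma tr_coboundary0P x :
  (exists g : {linear {linear P1 -> C} -> C}, forall f : {linear P0 -> C},
     f x = g (hom_pre C d1 f)) <-> d0 x = 0.
Proof.
split=> [[g gE]|/d0_exact[y <-]]; last by exists (hom_eval C y).
have [y yP] := hom_eval_surj homothety_surj P1_add g.
apply/d0_exact; exists y; apply/eqP; rewrite -subr_eq0; apply/eqP.
apply: (hom_eval_inj homothety_inj P0_add) => f.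
by rewrite linearB gE yP subrr.
Qed.

(** Only n = 0 needs an argument: maps from Hom(P0, C) to C are evaluations at points of P0, and P0
    maps onto M, so the coboundaries are the image of [d]. *)
Lemma tr_coboundaryP n (z : K n) :
  (exists g : {linear tr_res_obj n.+1 -> C}, forall x, z x = g (tr_res_d n.+1 x)) <->
  z \in boundaries (aug_d d dK) n.+1.
Proof.
case: n z => [|n] z; split=> [[g gE]|/asboolP[w]].
- have [y yP] := hom_eval_surj homothety_surj P0_add g.
  apply/asboolP; exists (d0 y); apply: linear_ext => u /=.
  by rewrite dE gE yP.
- have [x <-] := d0_surj w => zE; have {}zE : d (d0 x) = z := zE.
  by exists (hom_eval C x) => u; rewrite -zE dE.
- by apply/asboolP; exists g; apply: linear_ext => u; rewrite gE.
- move=> zE; have {}zE : hom_pre C (tr_res_d n.+2) w = z := zE.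
  by exists w => x; rewrite -zE.
Qed.

Lemma tr_cocycleP n (z : K n) :
  (forall y, z (tr_res_d n.+2 y) = 0) <-> dK n z = 0.
Proof.
split=> [zq|/linear_congr zE y]; first exact: linear_ext.
exact: (zE y).
Qed.

Lemma tr_cocycle0P x : (forall u, tr_res_d 1 u x = 0) <-> d (d0 x) = 0.
Proof.
split=> [xq|/linear_congr zE y]; first by apply: linear_ext => u; rewrite dE xq.
by rewrite -dE zE.
Qed.

Let Ext_zeroP j := Ext_of_acyclic_zeroP (std_resolution (Tr C d1))
  tr_eps_surj tr_eps_exact tr_res_exact tr_res_acyclic j.
Let Ext_associatedP j p := Ext_of_acyclic_associatedP (std_resolution (Tr C d1))
  tr_eps_surj tr_eps_exact tr_res_exact tr_res_acyclic j p.

Lemma tr_complex_zeroP j :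
  is_zero (Ext j.+1 (Tr C d1) C) <-> cohomology_zero (aug_d d dK) j.
Proof.
rewrite Ext_zeroP; case: j => [|j]; split=> H z.
- have [x <-] := d0_surj z => /tr_cocycle0P xq.
  have [g gE] := H (hom_eval C x) xq.
  by apply/eqP/tr_coboundary0P; exists g.
- have [x zE] := hom_eval_surj homothety_surj P0_add z => zq.
  have /H/eqP/tr_coboundary0P[g gE] : d (d0 x) = 0.
    by apply/tr_cocycle0P => u; rewrite -zE.
  by exists g => f; rewrite zE.
- by move=> /tr_cocycleP/H/tr_coboundaryP.
- by move=> /tr_cocycleP/H/tr_coboundaryP.
Qed.

Lemma tr_complex_associatedP j p :
  is_associated p (Ext j.+1 (Tr C d1) C) <->
  cohomology_associated (aug_d d dK) p j.
Proof.
rewrite Ext_associatedP; case: j => [|j]; split=> -[z zq zP].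
- have [x zE] := hom_eval_surj homothety_surj P0_add z.
  exists (d0 x); first by apply/tr_cocycle0P => u; rewrite -zE.
  move=> a; apply/idP/idP.
    move/zP => [g gE]; apply/eqP; rewrite -linearZ; apply/tr_coboundary0P.
    by exists g => f; rewrite linearZ /= -zE.
  move=> /eqP; rewrite -linearZ => /tr_coboundary0P[g gE].
  by apply/zP; exists g => f; rewrite zE -linearZ.
- move: zq zP; have [x <-] := d0_surj z => /tr_cocycle0P xq zP.
  exists (hom_eval C x) => // a; rewrite zP; split.
    move=> /eqP; rewrite -linearZ => /tr_coboundary0P[g gE].
    by exists g => f; rewrite -gE /= linearZ.
  move=> [g gE]; apply/eqP; rewrite -linearZ; apply/tr_coboundary0P.
  by exists g => f; rewrite linearZ /= -gE.
- exists z; first exact/tr_cocycleP.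
  move=> a; apply/idP/idP.
    by move/zP => zc; exact/(tr_coboundaryP (lin_scale a z)).
  by move=> /(tr_coboundaryP (lin_scale a z)) zc; apply/zP.
- exists z; first exact/tr_cocycleP.
  move=> a; rewrite zP; split.
    by move/(tr_coboundaryP (lin_scale a z)).
  by move=> zc; exact/(tr_coboundaryP (lin_scale a z)).
Qed.

End TransposeComplex.

Lemma tr_complex_exists (R : comNzRingType) (M C P0 P1 : lmodType R)
    (d1 : {linear P1 -> P0}) (d0 : {linear P0 -> M}) :
  noetherian R -> semidualizing C -> fg_proj_presentation d1 d0 ->
  exists (K : nat -> lmodType R) (d : {linear M -> K 0%N})
         (dK : forall n, {linear K n -> K n.+1}),
  [/\ forall n, in_add C (K n),
      forall n x, aug_d d dK n.+1 (aug_d d dK n x) = 0,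
      forall j, is_zero (Ext j.+1 (Tr C d1) C) <->
        cohomology_zero (aug_d d dK) j &
      forall j p, is_associated p (Ext j.+1 (Tr C d1) C) <->
        cohomology_associated (aug_d d dK) p j].
Proof.
move=> noethR sdC presM; have [C_fg _ _] := sdC.
have [[P0_fg P0_proj] _ d0_surj d0_exact] := presM.
have noethH : noetherian_module {linear P0 -> C}.
  exact/(fg_noetherian noethR)/(in_add_fg C_fg)/hom_in_add/fg_projective_in_add.
have [m [e0 [e [e0_exact e_exact0 e_exact]]]] :=
  free_resolution_exists (hom_pre C d1) noethR noethH.
have ev_lin : linear (fun x : P0 => hom_eval C x \o e0 : {linear 'rV[R]_(m 0%N) -> C}).
  by move=> a x y; apply: linear_ext => u /=; rewrite linearP.
(* Each [e0 u] vanishes on the image of [d1], so evaluation of it descends from P0 to M. *)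
have [d dP] : exists d : {linear M -> {linear 'rV[R]_(m 0%N) -> C}},
    forall x, d (d0 x) = mklinear ev_lin x.
  apply: factor_surj => // x /d0_exact[y <-]; apply: linear_ext => u /=.
  have e0u : hom_pre C d1 (e0 u) = 0 by apply/e0_exact; exists u.
  exact: (linear_congr e0u y).
have dE x u : d (d0 x) u = e0 u x by rewrite dP.
exists (fun n => {linear tr_res_obj C P0 P1 m n.+2 -> C}), d,
  (fun n => hom_pre C (tr_res_d d1 e0 e n.+2)); split.
- by move=> n; exact/hom_in_add/rV_in_add.
- exact: (tr_complex_sq0 presM e0_exact).
- exact: (tr_complex_zeroP sdC presM e0_exact).
- exact: (tr_complex_associatedP sdC presM e0_exact).
Qed.

(** * Ext in the second variable and regular sequences *)

Section ExtSecond.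
Variables (R : comNzRingType) (X : lmodType R) (G : resolution X).
Implicit Types A B D N U V W : lmodType R.

Definition is_coboundary N j : {linear res_obj G j -> N} -> Prop :=
  match j return {linear res_obj G j -> N} -> Prop with
  | 0 => fun f => forall x, f x = 0
  | i.+1 => fun f => exists g : {linear res_obj G i -> N},
      forall x, f x = g (res_d G i x)
  end.

Definition Ext_zero j N : Prop :=
  forall f : {linear res_obj G j -> N},
    (forall y, f (res_d G j y) = 0) -> is_coboundary f.

(** Injectivity of Ext^(j+1)(X, A) -> Ext^(j+1)(X, B): since Ext^j(X, D) = 0, g can be corrected by
    a coboundary so as to land in A. It serves again with [i] a multiplication by a regular
    element. *)
Lemma Ext_zero_connecting A B D (i : {linear A -> B}) (p : {linear B -> D}) j :
  ses i p -> Ext_zero j D ->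
  forall (f : {linear res_obj G j.+1 -> A}) (g : {linear res_obj G j -> B}),
    (forall x, i (f x) = g (res_d G j x)) ->
  exists h : {linear res_obj G j -> A}, forall x, f x = h (res_d G j x).
Proof.
move=> sip D0 f g fg; have [i_inj p_surj ex] := sip.
suff [g' pg' g'd] : exists2 g' : {linear res_obj G j -> B},
    forall x, p (g' x) = 0 & forall x, g' (res_d G j x) = g (res_d G j x).
  have [h hP] : exists h : {linear res_obj G j -> A}, forall x, i (h x) = g' x.
    by apply: factor_inj => // x; apply/ex.
  by exists h => x; apply: i_inj; rewrite fg hP g'd.
have pgd y : (p \o g) (res_d G j y) = 0 by rewrite /= -fg (ses_comp0 _ sip).
case: j D0 f g fg pgd => [|j] D0 f g fg pgd.
  by exists g => // x; exact: D0 pgd x.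
have [h hP] := D0 _ pgd.
have [h' h'P] := res_projective h p_surj.
exists (g \- (h' \o res_d G j)) => x /=.
  by rewrite linearB h'P -hP subrr.
have -> : res_d G j (res_d G j.+1 x) = 0 by apply/res_exact; exists x.
by rewrite linear0 subr0.
Qed.

Lemma Ext_zero_sub A B D (i : {linear A -> B}) (p : {linear B -> D}) j :
  ses i p -> Ext_zero j D -> Ext_zero j.+1 B -> Ext_zero j.+1 A.
Proof.
move=> sip D0 B0 f fd.
have [|g gP] := B0 (i \o f); first by move=> y /=; rewrite fd linear0.
exact: Ext_zero_connecting sip D0 f g gP.
Qed.

(** Lift the cocycle to B; its differential is a cocycle with values in A, and a cochain bounding it
    corrects the lift to a cocycle. *)
Lemma Ext_zero_quot A B D (i : {linear A -> B}) (p : {linear B -> D}) j :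
  ses i p -> Ext_zero j B -> Ext_zero j.+1 A -> Ext_zero j D.
Proof.
move=> sip B0 A0 f fd; have [i_inj p_surj ex] := sip.
have [f' f'P] := res_projective f p_surj.
have [u uP] : exists u : {linear res_obj G j.+1 -> A},
    forall x, i (u x) = (f' \o res_d G j) x.
  by apply: factor_inj => // x; apply/ex; rewrite /= f'P fd.
have [|v vP] := A0 u.
  move=> y; apply: i_inj; rewrite uP /=.
  have -> : res_d G j (res_d G j.+1 y) = 0 by apply/res_exact; exists y.
  by rewrite !linear0.
have pf x : f x = p ((f' \- (i \o v)) x).
  by rewrite /= linearB (ses_comp0 _ sip) subr0 f'P.
have fvd y : (f' \- (i \o v)) (res_d G j y) = 0 by rewrite /= -vP uP subrr.
have := B0 _ fvd; case: j f f' v pf {B0 A0 fd f'P u uP vP fvd} => [|j] f f' v pf.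
  by move=> z x; rewrite pf z linear0.
by move=> [g gP]; exists (p \o g) => x; rewrite pf gP.
Qed.

Lemma Ext_zero_in_add U V j : in_add U V -> Ext_zero j U -> Ext_zero j V.
Proof.
move=> [n [i [p ipP]]] U0 f fd.
have H k : is_coboundary (p k \o f).
  by apply: U0 => y /=; rewrite fd linear0.
case: j f fd U0 H => [|j] f fd U0 H /=.
  move=> x; rewrite (ipP (f x)) big1 // => k _.
  by have /= -> := H k x; rewrite linear0.
have [g gP] := choice H.
have s_lin : linear (fun x => \sum_(k < n) i k (g k x)).
  move=> a x y; rewrite scaler_sumr -big_split; apply: eq_bigr => k _ /=.
  by rewrite !linearP.
exists (mklinear s_lin) => x; rewrite (ipP (f x)); apply: eq_bigr => k _.
by rewrite -(gP k x).
Qed.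

Lemma Ext_zero_retract V W (s : {linear V -> W}) (r : {linear W -> V}) j :
  (forall v, r (s v) = v) -> Ext_zero j W -> Ext_zero j V.
Proof.
move=> rs; apply: Ext_zero_in_add; exists 1%N, (fun=> r), (fun=> s) => v.
by rewrite big_ord1.
Qed.

(** Multiplication by x is zero on X, hence null-homotopic on the resolution. Only the identity d s
    + s d = x composed with d is kept: it involves a single s and suffices both for the induction
    and for [annihilator_coboundary]. *)
Lemma annihilator_homotopy x : (forall v : X, x *: v = 0) ->
  forall j, exists s : {linear res_obj G j -> res_obj G j.+1},
    forall y, res_d G j (s (res_d G j y)) = x *: res_d G j y.
Proof.
move=> xX; elim=> [|j [s sP]].
  have [|s sP] := projective_lift (e := res_d G 0) (f := homothety _ x)
    (@res_projective _ _ G 0).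
    by move=> y; apply/res_exact0; rewrite linearZ /= xX.
  by exists s => y; rewrite sP.
have [|s' s'P] := projective_lift (e := res_d G j.+1)
    (f := homothety _ x \- (s \o res_d G j)) (@res_projective _ _ G j.+1).
  by move=> y; apply/res_exact; rewrite /= linearB linearZ /= sP subrr.
exists s' => y; rewrite s'P /=.
have -> : res_d G j (res_d G j.+1 y) = 0 by apply/res_exact; exists y.
by rewrite linear0 subr0.
Qed.

Lemma annihilator_coboundary x N j (f : {linear res_obj G j -> N}) :
  (forall v : X, x *: v = 0) -> (forall y, f (res_d G j y) = 0) ->
  is_coboundary (x \*: f).
Proof.
move=> xX; case: j f => [|j] f fd /=.
  move=> y; rewrite -linearZ.
  have /res_exact0[w <-] : res_aug G (x *: y) = 0 by rewrite linearZ /= xX.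
  exact: fd.
have [s sP] := annihilator_homotopy xX j.
exists (f \o s) => y /=; apply/eqP; rewrite -linearZ -subr_eq0 -linearB; apply/eqP.
have /res_exact[w <-] : res_d G j (x *: y - s (res_d G j y)) = 0.
  by rewrite linearB sP linearZ subrr.
exact: fd.
Qed.

End ExtSecond.

(** * Regular sequences and vanishing of Ext *)

Section RegularSequences.
Variable S : comNzRingType.
Implicit Types N : lmodType S.

Definition modx N (x : S) : lmodType S := quotmod (limage (homothety N x)).
Definition modx_pi N (x : S) : {linear N -> modx N x} := quotmod_pi _.

Lemma modx_surj N x (y : modx N x) : exists n, modx_pi N x n = y.
Proof. by exists (repr y); exact: quotmod_piK. Qed.

Lemma modx_eq0 N x n : modx_pi N x n = 0 <-> exists n', x *: n' = n.
Proof.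
by split=> [/eqP|xP]; [|apply/eqP]; rewrite quotmod_pi_eq0; [move/asboolP|apply/asboolP].
Qed.

Lemma modx_ses N x : (forall n : N, x *: n = 0 -> n = 0) ->
  ses (homothety N x) (modx_pi N x).
Proof.
move=> x_reg; split; [|exact: modx_surj|exact: modx_eq0].
move=> n n' /= e; apply/eqP; rewrite -subr_eq0; apply/eqP/x_reg.
by rewrite scalerBr e subrr.
Qed.

Lemma seq_mul_nil N (n : N) : seq_mul [::] n <-> n = 0.
Proof.
split=> [[c ->]|->]; first by rewrite big_ord0.
by exists (fun=> 0); rewrite big_ord0.
Qed.

Lemma seq_mul_cons N x s (n : N) : seq_mul (x :: s) n <-> seq_mul s (modx_pi N x n).
Proof.
split=> [[c ->]|[c cP]].
  exists (fun i => modx_pi N x (c (lift ord0 i))).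
  rewrite big_ord_recl linearD linear_sum /=.
  have -> : modx_pi N x (x *: c ord0) = 0 by apply/modx_eq0; exists (c ord0).
  by rewrite add0r; apply: eq_bigr => i _; rewrite linearZ.
have [c' c'P] := choice (fun i => modx_surj (c i)).
have /modx_eq0[n' n'P] : modx_pi N x (n - \sum_(i < size s) s`_i *: c' i) = 0.
  rewrite linearB cP linear_sum; apply/eqP; rewrite subr_eq0; apply/eqP.
  by apply: eq_bigr => i _; rewrite linearZ c'P.
exists (fun i => if unlift ord0 i is Some j then c' j else n').
rewrite big_ord_recl unlift_none /= n'P -[LHS](subrK (\sum_(i < size s) s`_i *: c' i)).
by congr (_ + _); apply: eq_bigr => i _; rewrite liftK.
Qed.

(** This recursive form, passing from N to N / xN, is the one on which inductions on sequences
    run. *)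
Lemma regular_seq_cons N x s : regular_seq N (x :: s) <->
  (forall n : N, x *: n = 0 -> n = 0) /\ regular_seq (modx N x) s.
Proof.
split=> [[reg [n nP]]|[x_reg [reg [y yP]]]].
  split; first by move=> n' xn; apply/seq_mul_nil/(reg 0%N) => //; exact/seq_mul_nil.
  split; last by exists (modx_pi N x n) => /seq_mul_cons.
  move=> i lt_i y; have [n' <-] := modx_surj y; rewrite -linearZ => H.
  by apply/seq_mul_cons/(reg i.+1) => //; exact/seq_mul_cons.
split; last by have [n nE] := modx_surj y; exists n => /seq_mul_cons; rewrite nE.
case=> [|i] lt_i n /=; first by move=> /seq_mul_nil/x_reg->; exact/seq_mul_nil.
move=> /seq_mul_cons; rewrite linearZ => H; apply/seq_mul_cons.
exact: reg H.
Qed.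

Lemma regular_seq_nil N : ~ is_zero N -> regular_seq N [::].
Proof.
move=> N0; split=> //; apply/not_existsP => H; apply: N0 => n.
by apply/seq_mul_nil; apply: contrapT; exact: H.
Qed.

(** On Ext^j(X, N) the first element x acts as zero because it kills X, and injectively because
    Ext^(j-1)(X, N / xN) = 0 by induction. *)
Lemma regular_Ext_zero (X : lmodType S) (G : resolution X) N s :
  (forall x, x \in s -> forall v : X, x *: v = 0) -> regular_seq N s ->
  forall j, (j < size s)%N -> Ext_zero G j N.
Proof.
elim: s N => [|x s IHs] N sX // /regular_seq_cons[x_reg reg] j lt_j f fd.
have xX : forall v : X, x *: v = 0 by apply: sX; rewrite mem_head.
have := annihilator_coboundary xX fd; case: j lt_j f fd => [|j] lt_j f fd /=.
  by move=> xf y; apply: x_reg; exact: xf.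
move=> [g gP]; apply: (Ext_zero_connecting (modx_ses x_reg) _ gP).
by apply: IHs => // y ys; apply: sX; rewrite inE ys orbT.
Qed.

End RegularSequences.

(** * Depth over a noetherian local ring *)

Section MaximalAnnihilators.
Variable S : comNzRingType.
Implicit Types N V : lmodType S.

(** Otherwise dependent choice gives a strictly ascending chain, whose union is finitely generated
    and thus contained in one of its terms. *)
Lemma noetherian_max V (F : submod V -> Prop) : noetherian_module V ->
  (exists U, F U) ->
  exists2 U, F U & forall U', F U' -> {subset U <= U'} -> {subset U' <= U}.
Proof.
move=> noethV [U0 FU0]; apply: contrapT => H.
have step (n : nat) U : F U -> exists U', F U' /\
    ({subset U <= U'} /\ exists2 x, x \in U' & x \notin U).
  move=> FU; apply: contrapT => H'; apply: H; exists U => // U' FU' sUU' x U'x.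
  apply: contrapT => /negP Ux; apply: H'; exists U'; split=> //; split=> //.
  by exists x.
have [f [_ fP]] := dependent_nat_choice FU0 step.
have mono i j : (i <= j)%N -> {subset f i <= f j}.
  move=> /subnK <-; elim: (j - i)%N => [|k IHk] x // xi.
  by rewrite addSn; apply: (fP _).1; exact: IHk.
have Ucl : submod_closed [pred x | `[< exists n, x \in f n >]].
  split; first by apply/asboolP; exists 0%N; exact: rpred0.
  move=> a x y /asboolP[i xi] /asboolP[j yj]; apply/asboolP; exists (maxn i j).
  apply: rpredD; last exact: mono (leq_maxr i j) _ yj.
  exact/rpredZ/(mono _ _ (leq_maxl i j)).
have [k [g gP]] := noethV (Submod Ucl).
have /choice[h hP] : forall i : 'I_k, exists n, val (g i) \in f n.
  by move=> i; have /asboolP := valP (g i).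
have [x xf /negP[]] := (fP (\max_i h i)).2.
have Ux : x \in Submod Ucl by apply/asboolP; exists (\max_i h i).+1.
have [c /(congr1 val)] := gP (Submodule Ux).
rewrite (raddf_sum (\val : {linear submodule (Submod Ucl) -> V})) /= => ->.
apply: rpred_sum => i _; apply: rpredZ.
exact: mono (leq_bigmax i) _ (hP i).
Qed.

(** The annihilator of n is maximal among those of nonzero elements, hence an associated prime.
    Primes are represented by elements throughout, so avoiding one reads [a *: n <> 0]. *)
Definition max_ann N (n : N) : Prop :=
  n <> 0 /\ forall n' : N, n' <> 0 -> (forall a, a *: n = 0 -> a *: n' = 0) ->
    forall a, a *: n' = 0 -> a *: n = 0.

Lemma max_ann_exists N (n : N) : noetherian S -> n <> 0 ->
  exists2 n' : N, max_ann n' & forall a, a *: n = 0 -> a *: n' = 0.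
Proof.
move=> noethS n0.
have ann_lin (u : N) : linear (fun r : S^o => (r : S) *: u).
  by move=> a x y; rewrite scalerDl scalerA.
pose ann u := lkernel (mklinear (ann_lin u)).
have annP u a : a \in ann u <-> a *: u = 0 by split=> /eqP.
pose F U := exists u : N, [/\ u <> 0, {subset ann n <= ann u} & U = ann u].
have [|_ [u [u0 nu ->]] umax] := noetherian_max (F := F) noethS.
  by exists (ann n), n; split.
exists u; last by move=> a /annP/nu/annP.
split=> // u' u'0 uu' a /annP u'a; apply/annP.
apply: (umax (ann u')) u'a; last by move=> b /annP/uu'/annP.
by exists u'; split=> // b /nu/annP/uu'/annP.
Qed.

(** The annihilator of [b *: n] contains that of n, so it equals it by maximality. *)
Lemma max_ann_prime N (n : N) a b : max_ann n ->
  a *: n <> 0 -> b *: n <> 0 -> (a * b) *: n <> 0.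
Proof.
move=> [n0 nmax] an bn abn; apply: an.
apply: (nmax (b *: n)) => //; last by rewrite scalerA.
by move=> c cn; rewrite scalerA mulrC -scalerA cn scaler0.
Qed.

Lemma max_ann_prod N (n : N) (s : seq N) : max_ann n ->
  (forall l : N, l \in s -> exists2 a, a *: l = 0 & a *: n <> 0) ->
  exists2 a, forall l : N, l \in s -> a *: l = 0 & a *: n <> 0.
Proof.
move=> nmax; elim: s => [|l s IHs] H.
  by exists 1 => //; rewrite scale1r; case: nmax.
have [l' l's|a as0 an] := IHs; first by apply: H; rewrite inE l's orbT.
have [b bl bn] := H l (mem_head _ _).
exists (a * b); last exact: max_ann_prime.
move=> l'; rewrite inE => /predU1P[->|l's]; first by rewrite -scalerA bl scaler0.
by rewrite mulrC -scalerA as0 ?scaler0.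
Qed.

(** Choose s with maximal span. Any further n lies in that span, and if its annihilator lay in none
    of those of s, a product of scalars killing each member of s but not n would exist, a
    contradiction. *)
Lemma max_ann_finite N : noetherian_module N ->
  exists2 s : seq N, forall l : N, l \in s -> max_ann l &
    forall n : N, max_ann n -> exists2 l, l \in s & forall a, a *: n = 0 -> a *: l = 0.
Proof.
move=> noethN.
have span_closed (s : seq N) : submod_closed
    [pred x | `[< exists c : nat -> S, x = \sum_(i < size s) c i *: s`_i >]].
  split.
    by apply/asboolP; exists (fun=> 0); rewrite big1 // => i _; rewrite scale0r.
  move=> a x y /asboolP[c ->] /asboolP[e ->]; apply/asboolP.
  exists (fun i => a * c i + e i); rewrite scaler_sumr -big_split.
  by apply: eq_bigr => i _ /=; rewrite scalerA -scalerDl.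
pose span s := Submod (span_closed s).
pose F U := exists s, (forall l : N, l \in s -> max_ann l) /\ U = span s.
have [|_ [s [smax ->]] Umax] := noetherian_max (F := F) noethN.
  by exists (span [::]), [::]; split.
exists s => // n nmax; apply: contrapT => H.
have ns : n \in span s.
  apply: (Umax (span (n :: s))).
  - by exists (n :: s); split=> // l; rewrite inE => /predU1P[->|/smax].
  - move=> x /asboolP[c ->]; apply/asboolP.
    exists (fun i => if i is j.+1 then c j else 0).
    by rewrite big_ord_recl /= scale0r add0r.
  - apply/asboolP; exists (fun i => (i == 0)%:R).
    by rewrite big_ord_recl /= scale1r big1 ?addr0 // => i _; rewrite scale0r.
have [l ls|a as0 an] := @max_ann_prod N n s nmax.
  apply: contrapT => H'; apply: H; exists l => //.
  have [_ lmax] := smax l ls; apply: lmax; first by case: nmax.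
  by move=> a al; apply: contrapT => an; apply: H'; exists a.
apply: an; have /asboolP[c ->] := ns.
rewrite scaler_sumr big1 // => i _.
by rewrite scalerA mulrC -scalerA as0 ?scaler0 // mem_nth.
Qed.

(** Prime avoidance. If the scalar a found for s kills l, it is replaced by a + z * b, where z kills
    s but not l, and b in I does not kill l. *)
Lemma max_ann_avoid N (s : seq N) (I : submod S^o) :
  (forall l : N, l \in s -> max_ann l) ->
  (forall l : N, l \in s -> exists2 a : S, a \in I & a *: l <> 0) ->
  exists2 a : S, a \in I & forall l : N, l \in s -> a *: l <> 0.
Proof.
elim: s => [|l s IHs] smax H; first by exists 0 => //; exact: rpred0.
have [l' l's|l' l's|a Ia as0] := IHs.
- by apply: smax; rewrite inE l's orbT.
- by apply: H; rewrite inE l's orbT.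
have [al|al] := pselect (a *: l = 0); last first.
  by exists a => // l'; rewrite inE => /predU1P[->|/as0].
have lmax := smax l (mem_head _ _); have [b Ib bl] := H l (mem_head _ _).
have [l' l's|z zs zl] := @max_ann_prod N l s lmax.
  apply: contrapT => H'; apply: (as0 l' l's).
  have [_ l'max] : max_ann l' by apply: smax; rewrite inE l's orbT.
  apply: (l'max l) al; first by case: lmax.
  by move=> c cl'; apply: contrapT => cl; apply: H'; exists c.
exists (a + z * b); first exact/rpredD/(rpredZ (z : S)).
move=> l'; rewrite inE scalerDl => /predU1P[->|l's].
  by rewrite al add0r; exact: max_ann_prime.
by rewrite mulrC -scalerA zs // scaler0 addr0; exact: as0.
Qed.

Lemma regular_element_exists N (I : submod S^o) :
  noetherian S -> noetherian_module N ->
  (forall n : N, (forall a : S, a \in I -> a *: n = 0) -> n = 0) ->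
  exists2 a : S, a \in I & forall n : N, a *: n = 0 -> n = 0.
Proof.
move=> noethS noethN NI; have [s smax sP] := max_ann_finite noethN.
have [l ls|a Ia as0] := max_ann_avoid (I := I) smax.
  apply: contrapT => H; have [l0 _] := smax l ls; apply/l0/NI => a Ia.
  by apply: contrapT => al; apply: H; exists a.
exists a => // n an; apply: contrapT => /(max_ann_exists noethS)[n' n'max nn'].
have [l ls n'l] := sP _ n'max.
exact: (as0 l ls (n'l _ (nn' _ an))).
Qed.

End MaximalAnnihilators.

Lemma int_sup_geP (A : set int) (n : int) : A !=set0 ->
  (n%:E <= int_sup A)%E <-> exists2 a, A a & n <= a.
Proof.
move=> /int_supP[ub lub]; split=> [le_n|[a Aa le_na]]; last first.
  by apply: le_trans (ub a%:E _); [rewrite lee_fin | exists a].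
apply: contrapT => H.
(* If no member reaches n, integrality makes n - 1 an upper bound, against the supremum being at
   least n. *)
have : (n%:E <= (n - 1)%:E :> \bar int)%E.
  apply: le_trans le_n _; apply: lub => _ [a Aa <-]; rewrite lee_fin.
  have [|lt_an] := leP n a; last by lia.
  by move=> le_na; case: H; exists a.
rewrite lee_fin; lia.
Qed.

Section LocalDepth.
Variables (S : comNzRingType) (I : submod S^o).
Hypothesis noethS : noetherian S.
Hypothesis I_unit : forall x : S, x \notin I -> exists y : S, y * x = 1.
Hypothesis I_proper : (1 : S) \notin I.
Implicit Types N : lmodType S.

Lemma nakayama N (x : S) : x \in I -> finitely_generated N ->
  (forall n : N, exists n', x *: n' = n) -> is_zero N.
Proof.
move=> Ix [k [g gP]] xN; elim: k g gP => [|k IHk] g gP n.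
  by have [c ->] := gP n; rewrite big_ord0.
apply: (IHk (g \o lift ord0)) => {}n.
have [n' n'E] := xN (g ord0); have [c cE] := gP n'.
(* This scalar lies outside I and is a unit, so the first generator is a combination of the
   others. *)
have [|v vP] := I_unit (x := 1 - x * c ord0).
  apply/negP => H; move/negP: I_proper; apply.
  rewrite -(subrK (x * c ord0) 1); apply: rpredD => //.
  by rewrite mulrC; apply: (rpredZ (c ord0 : S)).
have g0 : g ord0 = \sum_(i < k) (v * x * c (lift ord0 i)) *: g (lift ord0 i).
  have gE : g ord0 - (x * c ord0) *: g ord0 =
      x *: \sum_(i < k) c (lift ord0 i) *: g (lift ord0 i).
    by rewrite -[X in X - _]n'E cE big_ord_recl scalerDr scalerA addrC addKr.
  rewrite -[LHS]scale1r -vP -scalerA scalerBl scale1r gE !scaler_sumr.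
  by apply: eq_bigr => i _; rewrite !scalerA mulrA.
have [e ->] := gP n; exists (fun i => e ord0 * (v * x * c (lift ord0 i)) + e (lift ord0 i)).
rewrite big_ord_recl [in LHS]g0 scaler_sumr -big_split; apply: eq_bigr => i _ /=.
by rewrite scalerA -scalerDl.
Qed.

Variable G : resolution (quotmod I).

(** A cocycle of degree 0 is a map S / I -> N, determined by the image of 1, which can be any
    element killed by I. *)
Lemma Ext_zero0P N : Ext_zero G 0 N <->
  forall n : N, (forall a : S, a \in I -> a *: n = 0) -> n = 0.
Proof.
split=> [N0 n nI|NI f fd].
  have r_lin : linear (fun r : S^o => (r : S) *: n).
    by move=> a x y; rewrite scalerDl scalerA.
  have [h hP] : exists h : {linear quotmod I -> N},
      forall r, h (quotmod_pi I r) = mklinear r_lin r.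
    apply: factor_surj => [x|r /eqP]; first by exists (repr x); exact: quotmod_piK.
    by rewrite quotmod_pi_eq0 => /nI.
  have [y yP] := @res_aug_surj _ _ G (quotmod_pi I 1).
  have hd w : (h \o res_aug G) (res_d G 0 w) = 0.
    have /= -> : res_aug G (res_d G 0 w) = 0 by apply/res_exact0; exists w.
    exact: linear0.
  by have /= := N0 _ hd y; rewrite yP hP /= scale1r.
have [h hP] : exists h : {linear quotmod I -> N}, forall x, h (res_aug G x) = f x.
  apply: factor_surj; first exact: res_aug_surj.
  by move=> x /res_exact0[y <-].
move=> x; rewrite -hP; set w := res_aug G x.
rewrite -(quotmod_piK w) -[repr w]mulr1 -[_ * _]/((repr w : S) *: (1 : S^o)).
have h1 : h (quotmod_pi I 1) = 0.
  apply: NI => a Ia; rewrite -!linearZ /=.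
  have -> : quotmod_pi I (a *: (1 : S^o)) = 0.
    by apply/eqP; rewrite quotmod_pi_eq0 -[_ *: _]/(a * 1) mulr1.
  exact: linear0.
by rewrite !linearZ /= h1 scaler0.
Qed.

(** Vanishing in degree 0 yields an N-regular x in I by prime avoidance. Modulo x one degree of
    vanishing is lost, and Nakayama keeps N / xN nonzero. *)
Lemma Ext_zero_regular N n : finitely_generated N -> ~ is_zero N ->
  (forall j, (j < n)%N -> Ext_zero G j N) ->
  exists s : seq S, [/\ size s = n, forall x, x \in s -> x \in I & regular_seq N s].
Proof.
elim: n N => [|n IHn] N fgN N0 NE.
  by exists [::]; split=> //; exact: regular_seq_nil.
have [x Ix x_reg] : exists2 x : S, x \in I & forall n : N, x *: n = 0 -> n = 0.
  apply: regular_element_exists => //; first exact: fg_noetherian.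
  exact/Ext_zero0P/NE.
have ses_x := modx_ses x_reg.
have [||j lt_jn|s [sz sI reg]] := IHn (modx N x).
- exact: fg_surj (@modx_surj _ N x) fgN.
- move=> Nx0; apply: N0; apply: (nakayama Ix fgN) => m.
  by apply/modx_eq0; exact: Nx0.
- by apply: (Ext_zero_quot ses_x); apply: NE; rewrite // ltnW.
exists (x :: s); split=> [|y|]; first by rewrite /= sz.
  by rewrite inE => /predU1P[->|/sI].
by apply/regular_seq_cons.
Qed.

Lemma depth_geP N (m : set S) n : (forall x, m x <-> x \in I) ->
  finitely_generated N ->
  (n%:Z%:E <= depth N m)%E <-> forall j, (j < n)%N -> Ext_zero G j N.
Proof.
move=> mI fgN; rewrite /depth; case: asboolP => [N0|N0].
  split=> [_ j _ f fd|_]; last exact: leey.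
  case: j f fd => [|j] f fd; first by move=> x; exact: N0.
  by exists \0 => x; exact: N0.
(* The empty sequence is regular on a nonzero module, so the supremum is over a nonempty set. *)
rewrite int_sup_geP; last first.
  by exists 0, [::] => //; split=> //; exact: regular_seq_nil.
split=> [[_ [s [sm reg] <-]]|NE].
  rewrite lez_nat => le_n j lt_jn; apply: (regular_Ext_zero _ reg).
    move=> x /sm/mI Ix v; rewrite -(quotmod_piK v) -linearZ; apply/eqP.
    rewrite quotmod_pi_eq0 -[_ *: _]/(x * repr v) mulrC.
    exact: (rpredZ (repr v : S)).
  exact: leq_trans lt_jn le_n.
have [s [sz sI reg]] := Ext_zero_regular fgN N0 NE.
exists n => //; exists s; last by rewrite sz.
by split=> // x /sI/mI.
Qed.

End LocalDepth.

(** * Localization *)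

Section LocalizationTheory.
Variables (R : comNzRingType) (p : prime_idealr R).
Implicit Types U V M : lmodType R.
Local Notation S := (loc_ring p).

Lemma frac0 M s : frac (0 : M) s = 0 :> localization p M.
Proof. by apply/frac_eqP; exists (den1 p); rewrite !scaler0. Qed.

Lemma frac_eq0 M (m : M) s :
  frac m s = 0 :> localization p M <-> exists w : denominator p, den w *: m = 0.
Proof.
split=> [/frac_eqP[w]|[w wm]]; last first.
  rewrite -(frac0 M (den1 p)); apply/frac_eqP; exists w.
  by rewrite scaler0 mulrC -scalerA wm scaler0.
by rewrite scaler0 /= mulr1 => wm; exists w.
Qed.

Lemma frac_add M (m n : M) s t :
  frac m s + frac n t = frac (den t *: m + den s *: n) (denM s t) :> localization p M.
Proof. exact: loc_add_frac. Qed.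

Lemma fracD M (m n : M) s : frac (m + n) s = frac m s + frac n s :> localization p M.
Proof.
rewrite frac_add; apply/frac_eqP; exists (den1 p) => /=.
by rewrite -scalerDr scalerA; congr (_ *: _); ring.
Qed.

Lemma fracZ M (r : R) s (m : M) t :
  (frac (r : R^o) s : S) *: frac m t = frac (r *: m) (denM s t) :> localization p M.
Proof. exact: loc_scale_frac. Qed.

Lemma frac_cancel M (w : denominator p) (m : M) s :
  frac (den w *: m) (denM w s) = frac m s :> localization p M.
Proof.
by apply/frac_eqP; exists (den1 p) => /=; rewrite scalerA; congr (_ *: _); ring.
Qed.

Lemma frac_sum M n (F : 'I_n -> M) s :
  frac (\sum_(i < n) F i) s = \sum_(i < n) frac (F i) s :> localization p M.
Proof.
by apply: (big_morph (fun m => frac m s : localization p M)) => [? ?|];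
  [exact: fracD | exact: frac0].
Qed.

Lemma frac_comb M n (c : 'I_n -> R) (g : 'I_n -> M) s :
  frac (\sum_(i < n) c i *: g i) s =
  \sum_(i < n) (frac (c i : R^o) s : S) *: frac (g i) (den1 p) :> localization p M.
Proof.
rewrite frac_sum; apply: eq_bigr => i _; rewrite fracZ.
by apply/frac_eqP; exists (den1 p) => /=; rewrite !scalerA; congr (_ *: _); ring.
Qed.

Definition loc_fun U V (f : {linear U -> V}) (x : localization p U) : localization p V :=
  frac (f (repr x).1) (repr x).2.

Lemma loc_funE U V (f : {linear U -> V}) u s :
  loc_fun f (frac u s) = frac (f u) s.
Proof.
have [w e] := repr_frac u s; apply/frac_eqP; exists w.
by rewrite -!linearZ e.
Qed.

Lemma loc_fun_linear U V (f : {linear U -> V}) : linear (loc_fun f).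
Proof.
elim/frac_ind=> r s; elim/frac_ind=> u t; elim/frac_ind=> v t'.
rewrite fracZ frac_add !loc_funE fracZ frac_add.
by rewrite linearD [f (den t' *: _)]linearZ [f (r *: _)]linearZ [f (den _ *: _)]linearZ.
Qed.
Definition loc_map U V (f : {linear U -> V}) :
  {linear localization p U -> localization p V} := mklinear (loc_fun_linear f).

Lemma loc_mapE U V (f : {linear U -> V}) u s :
  loc_map f (frac u s) = frac (f u) s.
Proof. exact: loc_funE. Qed.

Lemma loc_in_add U V : in_add U V -> in_add (localization p U) (localization p V).
Proof.
move=> [n [i [q iqP]]].
exists n, (fun k => loc_map (i k)), (fun k => loc_map (q k)).
elim/frac_ind => v s; rewrite [in LHS](iqP v) frac_sum.
by apply: eq_bigr => k _; rewrite (loc_mapE (q k) v s) loc_mapE.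
Qed.

Lemma loc_fg M : finitely_generated M -> finitely_generated (localization p M).
Proof.
move=> [n [g gP]]; exists n, (fun i => frac (g i) (den1 p)).
elim/frac_ind => m s; have [c ->] := gP m.
by exists (fun i => frac (c i : R^o) s); rewrite frac_comb.
Qed.

(** Generators of the contraction of J to R generate J, because the numerator of any fraction in J
    belongs to the contraction. *)
Lemma loc_noetherian : noetherian R -> noetherian S.
Proof.
move=> noethR J.
have I_closed : submod_closed [pred r : R^o | (frac r (den1 p) : S^o) \in J].
  split=> [|a x y]; rewrite !inE ?frac0 ?rpred0 // => Jx Jy.
  rewrite fracD; apply: rpredD => //.
  have -> : frac (a *: x) (den1 p) =
      (frac (a : R^o) (den1 p) : S) *: (frac x (den1 p) : S^o) :> S^o.
    rewrite [RHS](fracZ a (den1 p) x (den1 p)).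
    by apply/frac_eqP; exists (den1 p) => /=; congr (_ *: _); ring.
  exact: rpredZ.
have [n [g gP]] := noethR (Submod I_closed).
have Jg i : (frac (val (g i)) (den1 p) : S^o) \in J by exact: (valP (g i)).
exists n, (fun i => Submodule (Jg i)) => -[x Jx].
have [r [s xE]] : exists r s, x = frac (r : R^o) s :> S.
  by exists (repr x).1, (repr x).2; rewrite fracK.
have Ir : r \in Submod I_closed.
  rewrite inE.
  have -> : frac (r : R^o) (den1 p) = (frac (den s : R^o) (den1 p) : S) *: (x : S^o) :> S^o.
    rewrite xE [RHS](fracZ (den s) (den1 p) (r : R^o) s).
    apply/frac_eqP; exists (den1 p) => /=; rewrite scalerA.
    by congr (_ *: _); ring.
  exact: rpredZ.
have [c /(congr1 val)] := gP (Submodule Ir).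
rewrite (raddf_sum (\val : {linear submodule (Submod I_closed) -> R^o})) => rE.
exists (fun i => frac (c i : R^o) s); apply: val_inj.
rewrite (raddf_sum (\val : {linear submodule J -> S^o})) [val _]/= xE.
transitivity (\sum_(i < n) (frac (c i : R^o) s : S) *: (frac (val (g i)) (den1 p) : S^o)).
  by rewrite -[RHS](frac_comb c (fun i => val (g i)) s) -rE.
by apply: eq_bigr.
Qed.

Lemma loc_max_frac (a : R) s :
  loc_max (frac (a : R^o) s : S) <-> a \in (p : {pred R}).
Proof.
split=> [[b [t [pb /frac_eqP[w e]]]]|pa]; last by exists a, s.
have {}e : den w * den t * a = den w * den s * b := e.
have : den w * den t * a \in (p : {pred R}) by rewrite e idealMr.
rewrite prime_idealrM => /orP[|//]; rewrite prime_idealrM.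
by rewrite (negPf (valP w)) (negPf (valP t)).
Qed.

Lemma loc_max_closed : submod_closed [pred x : S^o | `[< loc_max (x : S) >]].
Proof.
split; first by apply/asboolP; rewrite -(frac0 _ (den1 p)); apply/loc_max_frac/rpred0.
elim/frac_ind=> a s; elim/frac_ind=> x t; elim/frac_ind=> y u.
move=> /asboolP/loc_max_frac px /asboolP/loc_max_frac py; apply/asboolP.
rewrite [X in X + _](fracZ a s (x : R^o) t) frac_add.
apply/loc_max_frac; rewrite -![_ *: _]/(_ * _).
by rewrite rpredD ?idealMr.
Qed.
Definition loc_ideal : submod S^o := Submod loc_max_closed.

Lemma loc_idealP (x : S) : loc_max x <-> x \in loc_ideal.
Proof. by split=> /asboolP. Qed.

Lemma loc_ideal_unit (x : S) : x \notin loc_ideal -> exists y : S, y * x = 1.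
Proof.
elim/frac_ind: x => a s /negP pa.
have {}pa : (a : R) \notin (p : {pred R}).
  by apply/negP => /(loc_max_frac a s)/loc_idealP.
exists (frac (den s : R^o) (Denominator pa)).
rewrite [LHS]loc_mul_frac; apply/frac_eqP; exists (den1 p) => /=.
by rewrite -![_ *: _]/(_ * _); ring.
Qed.

Lemma loc_ideal_proper : (1 : S) \notin loc_ideal.
Proof. by apply/negP => /loc_idealP/loc_max_frac; rewrite (negPf (den1_subproof p)). Qed.

Section LocalizedComplex.
Variables (K : nat -> lmodType R) (dK : forall n, {linear K n -> K n.+1}).

Definition loc_d n : {linear localization p (K n) -> localization p (K n.+1)} :=
  loc_map (dK n).

Lemma loc_boundariesP n (m : K n) s :
  frac m s \in boundaries loc_d n <->
  exists w : denominator p, den w *: m \in boundaries dK n.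
Proof.
case: n m => [|n] m.
  split=> [/eqP/frac_eq0[w wm]|[w /eqP wm]]; first by exists w; apply/eqP.
  by apply/eqP/frac_eq0; exists w.
split=> [/asboolP[y]|[w /asboolP[u uE]]].
  elim/frac_ind: y => u t; rewrite loc_mapE => /frac_eqP[w e].
  exists (denM w t); apply/asboolP; exists ((den w * den s) *: u).
  by rewrite linearZ /= e.
apply/asboolP; exists (frac u (denM w s)).
by rewrite loc_mapE uE frac_cancel.
Qed.

Lemma loc_cohomology_zero n : cohomology_zero dK n -> cohomology_zero loc_d n.
Proof.
move=> H; elim/frac_ind=> z s; rewrite loc_mapE => /frac_eq0[w wz].
by apply/loc_boundariesP; exists w; apply: H; rewrite linearZ.
Qed.

(** The right side says that Hom(k, -) is nonzero on the localized cohomology. Coming back to R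
    requires one denominator for all of p, which finite generation of p provides. *)
Lemma loc_cohomology_associated n : noetherian R ->
  cohomology_associated dK p n <->
  exists2 z, loc_d n z = 0 &
    (forall a : S, a \in loc_ideal -> a *: z \in boundaries loc_d n) /\
    z \notin boundaries loc_d n.
Proof.
move=> noethR; split=> [[z dz zP]|[z dz [zI zB]]].
  exists (frac z (den1 p)); first by rewrite loc_mapE dz frac0.
  split.
    elim/frac_ind=> a s /loc_idealP/loc_max_frac pa; rewrite fracZ.
    by apply/loc_boundariesP; exists (den1 p); rewrite scale1r -zP.
  by apply/negP => /loc_boundariesP[w]; rewrite -zP (negPf (valP w)).
elim/frac_ind: z dz zI zB => z s; rewrite loc_mapE => /frac_eq0[w0 w0z] zI zB.
have p_closed : submod_closed [pred a : R^o | a \in (p : {pred R})].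
  split=> [|a x y]; first exact: rpred0.
  by rewrite !inE => px py; apply: rpredD => //; exact: idealMr.
have [k [g gP]] := noethR (Submod p_closed).
have /choice[w wP] : forall i : 'I_k, exists w : denominator p,
    den w *: ((val (g i) : R) *: (den w0 *: z)) \in boundaries dK n.
  move=> i; pose a : S := frac (val (g i)) (den1 p).
  have Ia : a \in loc_ideal by apply/loc_idealP/loc_max_frac/(valP (g i)).
  have := zI a Ia; rewrite fracZ => /loc_boundariesP[w wz].
  have zE : den w *: ((val (g i) : R) *: (den w0 *: z)) =
      den w0 *: (den w *: ((val (g i) : R) *: z)).
    by rewrite !scalerA; congr (_ *: _); ring.
  by exists w; rewrite zE rpredZ.
pose W := \prod_(i < k) den (w i).
have pW : W \notin (p : {pred R}).
  rewrite /W; elim/big_ind: _ => [|x y px py|i _]; last exact: (valP (w i)).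
    exact: den1_subproof.
  by rewrite prime_idealrM negb_or px py.
(* The factor w0 makes the numerator a cocycle over R, and W makes every generator of p send it to a
   boundary. *)
exists ((W * den w0) *: z); first by rewrite linearZ /= -scalerA w0z scaler0.
move=> a; apply/idP/idP => [pa|az].
  have [c /(congr1 val)] := gP (Submodule (pa : (a : R^o) \in Submod p_closed)).
  rewrite (raddf_sum (\val : {linear submodule (Submod p_closed) -> R^o})) /= => ->.
  rewrite scaler_suml; apply: rpred_sum => i _.
  have -> : (c i *: val (g i) : R) *: ((W * den w0) *: z) =
      (c i * \prod_(j < k | j != i) den (w j)) *:
        (den (w i) *: ((val (g i) : R) *: (den w0 *: z))).
    rewrite /W (bigD1 i) //= !scalerA -[c i *: _]/(c i * _).
    by congr (_ *: _); ring.
  exact/rpredZ/wP.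
(* A scalar outside p sending this cocycle to a boundary would give, multiplied by W and w0, a
   denominator turning z / s into a boundary. *)
apply: contraT => pa; case/negP: zB; apply/loc_boundariesP.
have pW0 : a * (W * den w0) \notin (p : {pred R}).
  by rewrite !prime_idealrM !negb_or pa pW (valP w0).
by exists (Denominator pW0); rewrite -scalerA.
Qed.

End LocalizedComplex.
End LocalizationTheory.

(** * Ext along a complex *)

Section ExtAlongComplex.
Variables (S : comNzRingType) (I : submod S^o) (G : resolution (quotmod I)).
Variables (L : nat -> lmodType S) (dL : forall n, {linear L n -> L n.+1}).
Hypothesis dd : forall n x, dL n.+1 (dL n x) = 0.

Let coim n : lmodType S := quotmod (boundaries dL n).

(** The complex is cut at the quotients by boundaries: exactness at n embeds [coim n] into [L n.+1]
    by the differential, with cokernel [coim n.+1]. *)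
Lemma coimage_ses n : cohomology_zero dL n ->
  exists i : {linear coim n -> L n.+1}, ses i (quotmod_pi (boundaries dL n.+1)).
Proof.
move=> Hn; pose q : {linear L n -> coim n} := quotmod_pi (boundaries dL n).
have q_surj x : exists y, q y = x by exists (repr x); exact: quotmod_piK.
have q0 x : q x = 0 <-> x \in boundaries dL n.
  by split=> [/eqP|xB]; [|apply/eqP]; rewrite quotmod_pi_eq0.
have [i iP] : exists i : {linear coim n -> L n.+1}, forall x, i (q x) = dL n x.
  apply: factor_surj => // x /q0; case: n x {Hn q q_surj q0} => [|n] x.
    by move/eqP->; rewrite linear0.
  by move=> /asboolP[y <-]; rewrite dd.
exists i; split.
- move=> x y; have [x' <-] := q_surj x; have [y' <-] := q_surj y.
  rewrite !iP => e; apply/eqP; rewrite -subr_eq0 -linearB; apply/eqP/q0/Hn.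
  by rewrite linearB e subrr.
- by move=> x; exists (repr x); exact: quotmod_piK.
- move=> x; have eB : quotmod_pi (boundaries dL n.+1) x = 0 <-> x \in boundaries dL n.+1.
    by split=> [/eqP|xB]; [|apply/eqP]; rewrite quotmod_pi_eq0.
  rewrite eB; split=> [/asboolP[y <-]|[a <-]]; first by exists (q y).
  by have [y <-] := q_surj a; apply/asboolP; exists y; rewrite iP.
Qed.

Lemma Ext_zero_coim0 j : Ext_zero G j (coim 0) <-> Ext_zero G j (L 0%N).
Proof.
pose q : {linear L 0%N -> coim 0} := quotmod_pi (boundaries dL 0).
have [r rP] : exists r : {linear coim 0 -> L 0%N}, forall x, r (q x) = x.
  apply: (factor_surj (f := idfun : {linear L 0%N -> L 0%N})).
    by move=> x; exists (repr x); exact: quotmod_piK.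
  by move=> x /eqP; rewrite quotmod_pi_eq0 => /eqP.
split; first exact: Ext_zero_retract rP.
apply: (Ext_zero_retract (s := r) (r := q)) => x.
by rewrite -(quotmod_piK x) rP.
Qed.

(** Generalized to Ext^j of [coim n] with j + n < t. It lies between Ext^(j-1) of [coim n.+1] and
    Ext^j of [L n.+1], and for j = 0 the embedding into [L n.+1] suffices. *)
Lemma Ext_zero_below t c :
  (forall n, (n < t)%N -> cohomology_zero dL n) ->
  (forall n j, (j < c)%N -> Ext_zero G j (L n.+1)) ->
  forall j, (j < t)%N -> (j < c)%N -> Ext_zero G j (L 0%N).
Proof.
move=> H0 LE j lt_jt lt_jc; apply/Ext_zero_coim0.
have : (j + 0 < t)%N by rewrite addn0.
elim: j 0%N lt_jc {lt_jt} => [|j IHj] n lt_jc lt_t.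
  have [i si] := coimage_ses (H0 n lt_t); have [i_inj _ _] := si.
  move=> f fd x; apply: i_inj; rewrite linear0.
  apply: (LE n 0%N lt_jc (i \o f)) => y /=.
  by rewrite fd linear0.
have [i si] : exists i : {linear coim n -> L n.+1}, ses i (quotmod_pi (boundaries dL n.+1)).
  by apply/coimage_ses/H0; lia.
apply: (Ext_zero_sub si); last exact: LE.
by apply: IHj; lia.
Qed.

(** With Ext^j of the positive terms zero up to j = t, the shift becomes an equivalence, and Ext^t
    of [L 0] is traded for Hom(S / I, -) of [coim t]. *)
Lemma Ext_zero_top t :
  (forall n, (n < t)%N -> cohomology_zero dL n) ->
  (forall n j, (j <= t)%N -> Ext_zero G j (L n.+1)) ->
  Ext_zero G t (L 0%N) <->
  forall z, dL t z = 0 ->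
    (forall a : S, a \in I -> a *: z \in boundaries dL t) -> z \in boundaries dL t.
Proof.
move=> H0 LE; rewrite -Ext_zero_coim0.
have shift k n : (k + n)%N = t -> Ext_zero G k (coim n) <-> Ext_zero G 0 (coim t).
  elim: k n => [|k IHk] n knt; first by rewrite -knt.
  have [i si] : exists i : {linear coim n -> L n.+1}, ses i (quotmod_pi (boundaries dL n.+1)).
    by apply/coimage_ses/H0; lia.
  rewrite -(IHk n.+1); last by lia.
  split=> H.
    by apply: (Ext_zero_quot si) => //; apply: LE; lia.
  by apply: (Ext_zero_sub si) => //; apply: LE; lia.
rewrite (shift t 0%N) ?addn0 // Ext_zero0P.
have piP x : quotmod_pi (boundaries dL t) x = 0 <-> x \in boundaries dL t.
  by split=> [/eqP|xB]; [|apply/eqP]; rewrite quotmod_pi_eq0.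
split=> H z.
  move=> _ zI; apply/piP/H => a Ia; rewrite quotmod_piZ.
  exact/piP/zI.
rewrite -(quotmod_piK z); move: (repr z) => {}z zI.
have {}zI (a : S) : a \in I -> a *: z \in boundaries dL t.
  by move=> Ia; apply/piP; rewrite -quotmod_piZ; exact: zI.
apply/piP/H => //.
(* Passing from [coim t] to cohomology: the differential of z is killed by I in [L t.+1], where
   Hom(S / I, -) vanishes, so z is a cocycle. *)
have /Ext_zero0P : Ext_zero G 0 (L t.+1) by exact: LE.
apply=> a Ia; rewrite -linearZ; move: (zI a Ia).
case: t {H0 LE shift piP H zI} z => [|t] z; first by move/eqP->; rewrite linear0.
by move=> /asboolP[y <-]; rewrite dd.
Qed.

End ExtAlongComplex.

(** * The torsionfree index and the equivalence *)

Lemma torsionfree_index_natP (R : comNzRingType) (C P0 P1 : lmodType R)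
    (d1 : {linear P1 -> P0}) :
  (torsionfree_index C d1 < +oo)%E ->
  exists n : nat, torsionfree_index C d1 = n%:Z%:E /\
    forall i : int, torsionfree C d1 i <-> i <= n%:Z.
Proof.
move=> t_fin; have t_ge0 := torsionfree_index_ge0 C d1.
have [n nE] : exists n : nat, torsionfree_index C d1 = n%:Z%:E.
  case: (torsionfree_index C d1) t_fin t_ge0 => [[n|n]||] //.
  by exists n.
exists n; split=> // i.
have tf0 : torsionfree C d1 0.
  by move=> j j1; rewrite lez_nat leqn0; case: j j1.
have geP k := int_sup_geP k (ex_intro _ 0 tf0 : torsionfree C d1 !=set0).
split=> [tfi|le_in].
  by rewrite -lee_fin -nE; apply/geP; exists i.
(* The finite supremum is reached by some k, and torsionfreeness descends from k to every smaller
   integer. *)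
have /geP[k tfk le_nk] : (n%:Z%:E <= int_sup (torsionfree C d1))%E by rewrite -nE.
by move=> j j1 le_ji; apply: tfk => //; lia.
Qed.

Lemma ereal_int_succ_le (m : nat) (x : \bar int) :
  (m%:Z%:E < x)%E -> (m.+1%:Z%:E <= x)%E.
Proof. by case: x. Qed.

Theorem theorem1p1 (R : comNzRingType) (M C P0 P1 : lmodType R)
    (d1 : {linear P1 -> P0}) (d0 : {linear P0 -> M})
    (noethR : noetherian R)
    (fgM : finitely_generated M)
    (sdC : semidualizing C)
    (presM : fg_proj_presentation d1 d0)
    (t_fin : (torsionfree_index C d1 < +oo)%E) :
  (forall i : int, torsionfree C d1 i <-> Stilde C M i) <->
  (exists p : prime_idealr R,
     is_associated p (Ext (absz (fine (torsionfree_index C d1))).+1 (Tr C d1) C) /\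
     (torsionfree_index C d1 + 1 <= depth_at p C)%E).
Proof.
have [n [tE tfP]] := torsionfree_index_natP t_fin.
have [K [d [dK [K_add dd K_zero K_ass]]]] := tr_complex_exists noethR sdC presM.
have [fgC _ _] := sdC.
set dA := aug_d d dK in dd K_zero K_ass.
have tfn : torsionfree C d1 n by apply/tfP.
have A0 j : (j < n)%N -> cohomology_zero dA j.
  by move=> lt_jn; apply/K_zero; apply: tfn => //; rewrite lez_nat.
have loc_dd p j x : loc_d p dA j.+1 (loc_d p dA j x) = 0.
  by elim/frac_ind: x => u s; rewrite !loc_mapE dd frac0.
have loc_A0 p j : (j < n)%N -> cohomology_zero (loc_d p dA) j.
  by move=> lt_jn; exact/loc_cohomology_zero/A0.
pose G (p : prime_idealr R) := std_resolution (quotmod (loc_ideal p)).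
have depthP (p : prime_idealr R) (N : lmodType R) k : finitely_generated N ->
    (k%:Z%:E <= depth_at p N)%E <->
    forall j, (j < k)%N -> Ext_zero (G p) j (localization p N).
  move=> fgN; apply: depth_geP; [exact: loc_noetherian|exact: loc_ideal_unit|
    exact: loc_ideal_proper|exact: loc_idealP|exact: loc_fg].
have K_Ext p k : (k%:Z%:E <= depth_at p C)%E ->
    forall i j, (j < k)%N -> Ext_zero (G p) j (localization p (K i)).
  move=> /(depthP _ _ _ fgC) CE i j lt_jk.
  by apply: (Ext_zero_in_add (loc_in_add p (K_add i))); exact: CE.
(* The bound by min(t, depth C_p), phrased with a natural number k so that infinite depth needs no
   separate case. *)
have M_Ext p k : (k <= n)%N -> (k%:Z%:E <= depth_at p C)%E ->
    (k%:Z%:E <= depth_at p M)%E.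
  move=> le_kn le_kC; apply/depthP => // j lt_jk.
  apply: (@Ext_zero_below _ _ (G p) _ _ (loc_dd p) n k (loc_A0 p)) => //.
    exact: K_Ext.
  exact: leq_trans lt_jk le_kn.
(* Degrees below n are settled by [M_Ext], so only the vanishing of Ext^n(k, M_p) is in question. *)
have top p : (n.+1%:Z%:E <= depth_at p C)%E ->
    (n.+1%:Z%:E <= depth_at p M)%E <-> ~ cohomology_associated dA p n.
  move=> le_nC; rewrite depthP // loc_cohomology_associated //.
  have LE i j : (j <= n)%N -> Ext_zero (G p) j (localization p (aug_obj M K i.+1)).
    by move=> le_jn; exact: (K_Ext p n.+1).
  have topP := @Ext_zero_top _ _ (G p) _ _ (loc_dd p) n (loc_A0 p) LE.
  split=> [ME [z dz [zI /negP[]]]|H j].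
    by have /topP := ME n (ltnSn n); apply.
  rewrite ltnS leq_eqVlt => /predU1P[->|lt_jn].
    apply/topP => z dz zI; apply: contrapT => /negP zB; apply: H.
    by exists z.
  apply: (depthP p M n fgM).1 lt_jn; apply: M_Ext => //.
  by apply: le_trans le_nC; rewrite lee_fin; lia.
rewrite tE /=.
have -> : (n%:Z%:E + 1 = n.+1%:Z%:E :> \bar int)%E by rewrite -EFinD -addn1 PoszD.
(* If S~_i fails at p, then m = depth M_p is finite and m + 1 <= depth C_p. By [M_Ext], m + 1 <= n
   is impossible, so n <= m < i. *)
have gap p (i : int) : (depth_at p M < Order.min i%:E (depth_at p C))%E ->
    n%:Z < i /\ (n.+1%:Z%:E <= depth_at p C)%E.
  rewrite lt_min => /andP[lt_Mi lt_MC].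
  have ge0 : (0%:Z%:E <= depth_at p M)%E by apply/depthP.
  have [m mE] : exists m : nat, depth_at p M = m%:Z%:E.
    by case: (depth_at p M) lt_Mi ge0 => [[m|m]||] // _ _; exists m.
  have lt_mC : (m.+1%:Z%:E <= depth_at p C)%E.
    by apply: ereal_int_succ_le; rewrite -mE.
  have le_nm : (n <= m)%N.
    rewrite leqNgt; apply/negP => lt_mn.
    by have := M_Ext p m.+1 lt_mn lt_mC; rewrite mE lee_fin; lia.
  split; first by move: lt_Mi; rewrite mE lte_fin; lia.
  by apply: le_trans lt_mC; rewrite lee_fin; lia.
have SnP i : i <= n%:Z -> Stilde C M i.
  by move=> le_in p; rewrite leNgt; apply/negP => /gap[]; lia.
split=> [H|[p [/K_ass pA le_nC]]] .
  (* M is not (n + 1)-C-torsionfree, so (1) supplies a prime at which S~_(n+1) fails. *)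
  have : ~ Stilde C M n.+1 by move=> /H/tfP; rewrite lez_nat ltnn.
  move=> /existsNP[p /negP]; rewrite -ltNge => lt_M.
  have [_ le_nC] := gap _ _ lt_M; exists p; split=> //; apply/K_ass.
  apply: contrapT => /(top p le_nC); apply/negP; rewrite -ltNge.
  by move: lt_M; rewrite lt_min => /andP[].
(* For i > n, the condition S~_i at p would force depth M_p >= n + 1, which [top] forbids because p
   is associated. *)
move=> i; rewrite tfP; split=> [/SnP//|Si].
rewrite leNgt; apply/negP => lt_ni.
have le_nM : (n.+1%:Z%:E <= depth_at p M)%E.
  by apply: le_trans (Si p); rewrite le_min le_nC andbT lee_fin; lia.
exact: (top p le_nC).1 le_nM pA.
Qed.
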